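(* Suppose that $(\mathcal{T}_n)_{n=1}^\infty$ is a sequence of random finite unlabeled rooted trees that converges in the probability fringe sense to a sin-tree $\mathcal{T} = (\mathcal{T}^0, \mathcal{T}^1, \ldots)$. Let $F_n$ denote the spectral distribution of the adjacency matrix of $\mathcal{T}_n$. Then the following are true. (a) There exists a deterministic probability distribution $F$ on $\mathbb{R}$ (depending on the model) such that $F_n$ converges in distribution to $F$ in the topology of weak convergence of probability measures on $\mathbb{R}$. (b) For any $\gamma \in \mathbb{R}$, $F_n(\{\gamma\})$ converges in distribution to a (model dependent) constant $c_\gamma$ as $n \to \infty$. Moreover, $F(\{\gamma\}) \ge c_\gamma$. (c) Consider a forest $\mathbf{u}$ composed of finitely many finite unlabeled rooted trees, and assume that some eigenvalue $\gamma$ of the adjacency matrix of $\mathbf{u}$ has multiplicity $L > 1$. Write $\mathcal{U}$ for the random forest obtained by deleting the root of $\mathcal{T}^0$ from $\mathcal{T}^0$, and suppose that $\mathbb{P}\{\mathcal{U} = \mathbf{u}\} > 0$. Then the constant $c_\gamma = \lim_{n \to \infty} F_n(\{\gamma\})$ is strictly positive, and hence $\gamma$ is an atom of the limiting spectral distribution $F$.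
   Context: Let $\mathbb{T}$ be the countable set of all finite unlabeled rooted trees (isomorphism classes of finite rooted trees, where isomorphisms preserve the root), with the discrete topology. Let $\mathbb{T}_\ast = \mathbb{T} \sqcup \{\ast\}$, where $\ast$ is an adjoined point, with the discrete topology, and give $\mathbb{T}^\infty$ and $\mathbb{T}_\ast^\infty$ (spaces of infinite sequences) the product topologies. For $\mathbf{t} \in \mathbb{T}$ with root $\rho$ and a vertex $v$ at distance $h \ge 0$ from the root, let $(v = v_0, v_1, \ldots, v_h = \rho)$ be the path from $v$ to the root. Let $t_0$ be the subtree rooted at $v_0$ consisting of all vertices whose path to the root passes through $v_0$ and, for $1 \le k \le h$, let $t_k$ be the subtree rooted at $v_k$ consisting of all vertices whose path to the root passes through $v_k$ but not through $v_{k-1}$. Let $\Phi(\mathbf{t}, \cdot)$ be the probability measure on $\mathbb{T}_\ast^\infty$ that places mass $(\#\mathbf{t})^{-1}$ at each of the sequences $(t_0, t_1, \ldots, t_h, \ast, \ast, \ldots)$ as $v$ ranges over the $\#\mathbf{t}$ vertices of $\mathbf{t}$ (masses are added in case of coincidences). A sequence $(\mathcal{T}_n)$ of random elements of $\mathbb{T}$ converges in the probability fringe sense to a $\mathbb{T}^\infty$-valued random variable $\mathcal{T} = (\mathcal{T}^0, \mathcal{T}^1, \ldots)$ if the random probability measures $\Phi(\mathcal{T}_n, \cdot)$ on $\mathbb{T}_\ast^\infty$ converge in distribution, in the topology of weak convergence of probability measures on $\mathbb{T}_\ast^\infty$, to the (deterministic) distribution of $\mathcal{T}$. An element $(t_0,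 t_1, \ldots)$ of $\mathbb{T}^\infty$ is called a sin-tree; it is identified with the infinite rooted tree obtained by joining the roots of $t_0, t_1, t_2, \ldots$ successively by edges to form a semi-infinite path. The spectral distribution of an $m \times m$ Hermitian matrix with eigenvalues $\mu_1, \ldots, \mu_m$ (with multiplicity) is $\frac{1}{m}\sum_{i=1}^m \delta_{\mu_i}$. Forests of unlabeled rooted trees are considered up to root-preserving isomorphism; deleting the root of a rooted tree yields the forest of subtrees rooted at the children of the root. *)

(* Defs.v *)
From HB Require Import structures.
From mathcomp Require Import all_boot all_order all_algebra finmap multiset.
From mathcomp Require Import generic_quotient.
From mathcomp Require Import complex.
From mathcomp Require Import all_classical all_reals all_analysis.
Import numFieldNormedType.Exports.
Import Order.TTheory GRing.Theory Num.Theory.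

Set Implicit Arguments.
Unset Strict Implicit.
Unset Printing Implicit Defensive.

Local Open Scope classical_set_scope.
Local Open Scope ring_scope.
Local Open Scope quotient_scope.

(* Finite rooted trees are represented by plane trees; the ordering of the
   children is then forgotten by passing to isomorphism classes. *)
Inductive ptree : Type := PNode of seq ptree.

Definition children (t : ptree) : seq ptree := let: PNode ts := t in ts.

Fixpoint ptree_enc (t : ptree) : GenTree.tree unit :=
  let: PNode ts := t in GenTree.Node 0 (map ptree_enc ts).

Fixpoint ptree_dec (t : GenTree.tree unit) : ptree :=
  if t is GenTree.Node _ ts then PNode (map ptree_dec ts) else PNode [::].

Lemma ptree_encK : cancel ptree_enc ptree_dec.
Proof.
rewrite /cancel; fix IH 1 => -[ts] /=; congr PNode.
by elim: ts => //= t ts ->; rewrite IH.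
Qed.

HB.instance Definition _ := Countable.copy ptree (can_type ptree_encK).

(* A vertex is the sequence of child indices met on the path from the root to
   it; the root is [::] and the distance to the root is the size. *)
Fixpoint vertices (t : ptree) : seq (seq nat) :=
  let: PNode ts := t in
  [::] :: flatten [seq [seq p.1 :: v | v <- p.2]
                  | p <- zip (iota 0 (size ts)) (map vertices ts)].

Lemma vertices_gt0 (t : ptree) : (0 < size (vertices t))%N.
Proof. by case: t. Qed.

Definition parent (v : seq nat) : seq nat := take (size v).-1 v.

Definition adjacent (v w : seq nat) : bool :=
  (v != [::]) && (parent v == w) || (w != [::]) && (parent w == v).

Definition rooted_iso (t t' : ptree) : Prop :=
  exists f g : seq nat -> seq nat,
    [/\ {in vertices t, forall v, f v \in vertices t' /\ g (f v) = v},
        {in vertices t', forall w, g w \in vertices t /\ f (g w) = w},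
        f [::] = [::] &
        {in vertices t &, forall v w, adjacent (f v) (f w) = adjacent v w}].

Definition rooted_isob : rel ptree := fun t t' => `[< rooted_iso t t' >].

Lemma rooted_iso_sym t t' : rooted_iso t t' -> rooted_iso t' t.
Proof.
case=> f [g [fV gV f0 fadj]]; exists g, f; split=> //.
  by rewrite -{1}f0; case: (fV [::]) => //; case: t {fV gV fadj}.
move=> v w /gV[vV fv] /gV[wV fw].
by rewrite -fadj // fv fw.
Qed.

Lemma rooted_isob_refl : reflexive rooted_isob.
Proof. by move=> t; apply/asboolP; exists id, id; split. Qed.

Lemma rooted_isob_sym : symmetric rooted_isob.
Proof. by move=> t t'; apply/asboolP/asboolP; apply: rooted_iso_sym. Qed.

Lemma rooted_isob_trans : transitive rooted_isob.
Proof.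
move=> t2 t1 t3 /asboolP[f [f' [fV f'V f0 fadj]]].
move=> /asboolP[g [g' [gV g'V g0 gadj]]]; apply/asboolP.
exists (g \o f), (f' \o g'); split=> /=.
- move=> v /fV[fv fK]; have [gfv gK] := gV _ fv.
  by rewrite gK.
- move=> w /g'V[gw gK]; have [fgw fK] := f'V _ gw.
  by rewrite fK.
- by rewrite f0.
- move=> v w vV wV; have [fv _] := fV _ vV; have [fw _] := fV _ wV.
  by rewrite gadj // fadj.
Qed.

Canonical rooted_iso_equiv :=
  EquivRel rooted_isob rooted_isob_refl rooted_isob_sym rooted_isob_trans.

Definition utree := {eq_quot rooted_iso_equiv}.
HB.instance Definition _ := [Countable of utree by <:%/].

Definition iso_class (t : ptree) : utree := \pi_(utree)%qT t.

HB.instance Definition _ := isPointed.Build utree (iso_class (PNode [::])).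
HB.instance Definition _ :=
  DiscreteTopology.copy utree (discrete_topology utree).

(* [None] is the adjoined point. *)
Definition utree_star := option utree.
HB.instance Definition _ := Pointed.on utree_star.
HB.instance Definition _ :=
  DiscreteTopology.copy utree_star (discrete_topology (option utree)).

HB.instance Definition _ (I : Type) (T : I -> ptopologicalType) :=
  isPointed.Build (prod_topology T) (fun=> point).

Definition sin_tree := {ptws nat -> utree}.
HB.instance Definition _ := PointedTopological.on sin_tree.

Definition star_seq := {ptws nat -> utree_star}.
HB.instance Definition _ := PointedTopological.on star_seq.

Notation borel E := (g_sigma_algebraType (@open E)).

Section decomposition.
Implicit Types (t : ptree) (v : seq nat) (k : nat).

Definition subtree t v : ptree :=
  foldl (fun s i => nth (PNode [::]) (children s) i) t v.

Definition remove_branch t i : ptree :=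
  PNode (take i (children t) ++ drop i.+1 (children t)).

(* The k-th vertex on the path from v to the root is [iter k parent v], and the
   last entry of its address is its rank among the children of the next one. *)
Definition spine_tree t v k : ptree :=
  if k is k'.+1 then
    remove_branch (subtree t (iter k parent v)) (last 0%N (iter k' parent v))
  else subtree t v.

Definition spine_seq t v : star_seq :=
  fun k => if (k <= size v)%N then Some (iso_class (spine_tree t v k)) else None.

End decomposition.

Section empirical.
Context d (T : measurableType d) (R : realType).
Variables (s : seq T) (s_gt0 : (0 < size s)%N).

Definition empirical of (0 < size s)%N : set T -> \bar R :=
  mscale ((size s)%:R^-1)%:nng
    (msum (fun i => \d_(nth point s i)) (size s)).

Local Notation emp := (empirical s_gt0).

HB.instance Definition _ := Measure.on emp.

Let empirical_setT : emp [set: T] = 1%E.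
Proof.
rewrite /empirical /mscale /= /msum.
under eq_bigr do rewrite /= diracT.
rewrite sumEFin sumr_const card_ord -EFinM mulVf //.
by rewrite pnatr_eq0 -lt0n.
Qed.

HB.instance Definition _ :=
  Measure_isProbability.Build _ _ _ emp empirical_setT.

End empirical.

Section Phi.
Variable R : realType.

Lemma spine_seqs_gt0 (t : ptree) :
  (0 < size [seq spine_seq t v | v <- vertices t])%N.
Proof. by rewrite size_map vertices_gt0. Qed.

(* Neither this nor [spectral_distribution] below depends on the chosen
   representative of the isomorphism class. *)
Definition Phi (t : utree) : probability (borel star_seq) R :=
  empirical R (s := [seq spine_seq (repr t) v | v <- vertices (repr t)]
                    : seq (borel star_seq))
    (spine_seqs_gt0 (repr t)).

End Phi.

Section weak_topology.
Variables (E : ptopologicalType) (R : realType).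

Definition bounded_continuous : Type :=
  {f : E -> R | continuous f /\ exists M, forall x, `|f x| <= M}.

Definition integrals (mu : probability (borel E) R) :
    {ptws bounded_continuous -> R} :=
  fun f => (\int[mu]_x (sval f x))%R.

Definition weak_prob := initial_topology integrals.
HB.instance Definition _ := Topological.on weak_prob.

End weak_topology.

(* Convergence in distribution, to a constant, of random elements [X n] of [E]
   that may be defined on different probability spaces. *)
Definition cvg_in_distribution (R : realType) (E : topologicalType)
    (d : nat -> measure_display) (Omega : forall n, measurableType (d n))
    (P : forall n, probability (Omega n) R)
    (X : forall n, Omega n -> E) (c : E) : Prop :=
  forall g : E -> R, continuous g -> (exists M, forall x, `|g x| <= M) ->
    (fun n => (\int[P n]_w g (X n w))%R) @ \oo --> g c.

Definition sin_star (s : sin_tree) : star_seq := fun k => Some (s k).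

Lemma continuous_sin_star : continuous sin_star.
Proof.
move=> s; apply/cvg_sup.
move=> k; move: s.
apply/(@continuousP _ (initial_topology (@^~ k))) => _ [B _ <-].
have projC : continuous (fun s : sin_tree => s k) by exact: proj_continuous.
exact: (continuousP (fun s : sin_tree => s k)).1 projC (Some @^-1` B)
  (discrete_open _).
Qed.

Lemma measurable_sin_star :
  measurable_fun setT (sin_star : borel sin_tree -> borel star_seq).
Proof.
apply: (@measurability _ _ (borel sin_tree) (borel star_seq) setT _
  (@open star_seq)) => // _ [U oU <-].
rewrite setTI; apply: sub_sigma_algebra.
by move/continuousP: continuous_sin_star; exact.
Qed.

Section random_sin_tree.
Context d (Omega : measurableType d) (R : realType).
Variables (P : probability Omega R) (T : {RV P >-> borel sin_tree}).

Definition star_RV : Omega -> borel star_seq := sin_star \o T.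

Lemma measurable_star_RV : measurable_fun setT star_RV.
Proof. exact: measurableT_comp measurable_sin_star (measurable_funPT T). Qed.

HB.instance Definition _ :=
  isMeasurableFun.Build _ _ _ _ star_RV measurable_star_RV.

End random_sin_tree.

Definition cvg_probability_fringe (R : realType)
    (d : nat -> measure_display) (Omega : forall n, measurableType (d n))
    (P : forall n, probability (Omega n) R)
    (T : forall n, {RV (P n) >-> borel utree})
    (d' : measure_display) (Omega' : measurableType d')
    (P' : probability Omega' R) (Tlim : {RV P' >-> borel sin_tree}) : Prop :=
  @cvg_in_distribution R (weak_prob star_seq R) d Omega P
    (fun n w => Phi R (T n w))
    (distribution P' (star_RV Tlim)).

Section spectrum.
Variable R : realType.

Definition adjacency_mx (V : seq (seq nat)) : 'M[R]_(size V) :=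
  \matrix_(i, j) (adjacent (nth [::] V i) (nth [::] V j))%:R.

(* Meant for symmetric matrices, whose spectrum over R[i] is real; see
   [char_poly_eigenvalues]. *)
Definition eigenvalues n (A : 'M[R]_n) : seq R :=
  [seq complex.Re (spectral_diag (map_mx (real_complex R) A) 0 i)
  | i <- enum 'I_n].

Lemma size_eigenvalues n (A : 'M[R]_n) : size (eigenvalues A) = n.
Proof. by rewrite size_map size_enum_ord. Qed.

Lemma char_poly_eigenvalues n (A : 'M[R]_n) : A^T = A ->
  char_poly A = \prod_(mu <- eigenvalues A) ('X - mu%:P).
Proof.
move=> sA; set B := map_mx (real_complex R) A.
have BH : B \is hermsymmx.
  apply/is_hermitianmxP; rewrite expr0 scale1r; apply/matrixP=> i j.
  have -> : B i j = real_complex R (A^T i j) by rewrite sA mxE.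
  by rewrite !mxE; apply/esym/conjc_real.
have /orthomx_spectralP := hermitian_normalmx BH.
set U := spectralmx B; set D := spectral_diag B => defB.
have D_real i : D 0 i = real_complex R (complex.Re (D 0 i)).
  by apply/esym/RRe_real/mxOverP/hermitian_spectral_diag_real.
apply: (map_poly_inj (real_complex R)).
rewrite map_char_poly rmorph_prod /= big_map big_enum /= -/B.
transitivity (char_poly (diag_mx D)).
  pose toP (M : 'M[R[i]]_n) := map_mx polyC M.
  have UV : toP (invmx U) *m toP U = 1%:M.
    by rewrite -[LHS]map_mxM /= mulVmx ?spectral_unit // map_mx1.
  have -> : char_poly B = \det (toP (invmx U) *m char_poly_mx (diag_mx D) *m toP U).
    congr (\det _); rewrite /char_poly_mx mulmxBr mulmxBl -!map_mxM /= -defB.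
    by rewrite scalar_mxC -mulmxA UV mulmx1.
  by rewrite !det_mulmx mulrAC -det_mulmx UV det1 mul1r.
rewrite char_poly_trig ?diag_mx_is_trig //; apply: eq_bigr => i _.
by rewrite mxE eqxx mulr1n map_polyXsubC; congr (_ - _%:P); exact: D_real.
Qed.

Definition tree_adjacency (t : ptree) := adjacency_mx (vertices t).

Lemma tree_eigenvalues_gt0 (t : ptree) :
  (0 < size (eigenvalues (tree_adjacency t)))%N.
Proof. by rewrite size_eigenvalues vertices_gt0. Qed.

Definition spectral_distribution (t : utree) : probability (borel R) R :=
  empirical R (s := eigenvalues (tree_adjacency (repr t)) : seq (borel R))
    (tree_eigenvalues_gt0 (repr t)).

(* A forest is the tree obtained by joining its components to a new root, minus
   this root. *)
Definition forest_vertices (ts : seq ptree) : seq (seq nat) :=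
  behead (vertices (PNode ts)).

Definition forest_adjacency (u : {mset utree}%mset) :=
  adjacency_mx (forest_vertices [seq repr t | t <- enum_mset u]).

End spectrum.

Definition delete_root (t : utree) : {mset utree}%mset :=
  seq_mset [seq iso_class s | s <- children (repr t)].

(* Main.v *)
(* For a tree t and a set a of reals let N_a(t) be the number of eigenvalues of
   t in a, and let the toll f_a(t) be N_a(t) minus the same count for t with its
   root deleted.  The tolls of the subtrees of t add up to N_a(t), so the mass
   that the spectral distribution of t gives to a is exactly the integral of
   f_a(t_0) under Phi(t, .).  By Cauchy interlacing the tolls of half-lines are
   bounded, and they depend on t_0 only, so probability fringe convergence makes
   the distribution functions and the atoms converge in probability, to the
   means of f_a(T^0).  Dominated convergence shows that the limit is a
   distribution function whose jumps are the limits of the atoms.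

   If deleting the root of a subtree leaves a forest having gamma as an
   eigenvalue of multiplicity at least 2, this subtree carries an eigenvector
   that vanishes at its root.  Subtrees with the same forest have the same size,
   so they are disjoint; extended by zero, these vectors are independent
   eigenvectors of the whole tree, and the multiplicity of gamma is at least the
   number of such subtrees, whose proportion stays away from 0. *)
Require Import Defs.
From HB Require Import structures.
From mathcomp Require Import all_boot all_order all_fingroup all_algebra.
From mathcomp Require Import finmap multiset generic_quotient complex.
From mathcomp Require Import ring lra zify.
From mathcomp Require Import all_classical all_reals all_analysis.
From mathcomp Require Import measurable_realfun.
Import numFieldNormedType.Exports.
Import Order.TTheory GRing.Theory Num.Theory.

Set Implicit Arguments.
Unset Strict Implicit.
Unset Printing Implicit Defensive.

Local Open Scope classical_set_scope.
Local Open Scope ring_scope.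

(* The sequences library of MathComp-Analysis has another [adjacent]. *)
Local Notation adjacent := Defs.adjacent.

(** * Eigenvalue counts of symmetric matrices *)

Section spectral_counting.
Variable R : realType.
Local Notation C := R[i].
Local Notation toC := (real_complex R).
Local Notation "M ^t*" := (map_mx Num.conj (M^T)) (at level 30).

Lemma mxrank_diag (F : fieldType) n (d : 'rV[F]_n) :
  \rank (diag_mx d) = #|[pred i | d 0 i != 0]|.
Proof.
elim: n d => [|n IH] d; first by rewrite flatmx0 mxrank0 eq_card0 // => -[].
pose d1 := @lsubmx F 1 1 n d; pose d2 := @rsubmx F 1 1 n d.
have -> : \rank (diag_mx d) = (\rank (diag_mx d1) + \rank (diag_mx d2))%N.
  rewrite -[in RHS]rank_diag_block_mx -diag_mx_row /d1 /d2.
  by rewrite (@hsubmxK F 1 1 n).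
rewrite IH (_ : diag_mx d1 = (d 0 0)%:M); last first.
  apply/matrixP=> i j; rewrite !mxE !ord1 /=; congr (d _ _ *+ _).
  exact: val_inj.
rewrite -[in RHS]sum1_card [RHS]big_mkcond big_ord_recl /=; congr (_ + _)%N.
  rewrite inE; have [->|d0] := eqVneq (d 0 0) 0; first by rewrite raddf0 mxrank0.
  by rewrite -scalemx1 mxrank_scale_nz // mxrank1.
rewrite -big_mkcond /= -sum1_card; apply: eq_bigl => i; rewrite !inE mxE.
by congr (d _ _ != 0); exact: val_inj.
Qed.

(* Courant-Fischer in compressed form: a vector in the span of the eigenvectors
   of [E] below [x] that is annihilated by the coordinates of [D] below [x]
   would have both quadratic forms on opposite sides of [x]. *)
Lemma card_compression_le m n (E : 'rV[R]_m) (D : 'rV[R]_n) (K : 'M[C]_(m, n))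
    (x : R) (b : bool) :
    K *m K^t* = 1%:M ->
    K *m diag_mx (map_mx toC D) *m K^t* = diag_mx (map_mx toC E) ->
  (#|[pred j | (E 0 j < x ?<= if b)%R]| <= #|[pred i | (D 0 i < x ?<= if b)%R]|)%N.
Proof.
move=> KK KDK.
pose ind p (a : pred 'I_p) : 'M[C]_p := diag_mx (\row_i (a i)%:R).
have rank_ind p (a : pred 'I_p) : \rank (ind p a) = #|a|.
  rewrite mxrank_diag; apply: eq_card => i; rewrite !inE !mxE /=.
  by rewrite -topredE /=; case: (a i); rewrite ?eqxx ?oner_eq0.
set a := [pred j | _]; set a' := [pred i | _].
(* The rows of [X] span the images under [K] of vectors supported on [a], those of [Y] the vectors
   supported off [a']. Once these spaces meet trivially, their ranks add up to at most [n]. *)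
pose X := ind m a *m K; pose Y := ind n (predC a').
have rX : \rank X = #|a|.
  rewrite /X mxrankMfree ?rank_ind //; apply/row_freeP.
  by exists (K^t*).
have XY : (X :&: Y)%MS = 0.
  apply/eqP/rowV0P => u; rewrite sub_capmx => /andP[/submxP[c0 uc] /submxP[y uy]].
  pose c := c0 *m ind m a.
  have {}uc : u = c *m K by rewrite uc /X mulmxA.
  have c_out j : ~~ a j -> c 0 j = 0.
    by move=> /negbTE aj; rewrite /c mul_mx_diag !mxE aj mulr0.
  have u_out i : a' i -> u 0 i = 0.
    by move=> ai; rewrite uy mul_mx_diag !mxE; move: ai => /= ->; rewrite mulr0.
  have quad p (v : 'rV[C]_p) (w : 'rV[R]_p) :
     (v *m diag_mx (map_mx toC w) *m v^t*) 0 0 = \sum_i toC (w 0 i) * `|v 0 i| ^+ 2.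
    rewrite mul_mx_diag mxE; apply: eq_bigr => i _.
    by rewrite !mxE normCK mulrAC mulrC.
  have norm p (v : 'rV[C]_p) : (v *m v^t*) 0 0 = \sum_i `|v 0 i| ^+ 2.
    by rewrite mxE; apply: eq_bigr => i _; rewrite !mxE normCK.
  have uct : u^t* = K^t* *m c^t* by rewrite uc trmx_mul map_mxM.
  have eqq : \sum_i toC (D 0 i) * `|u 0 i| ^+ 2 = \sum_j toC (E 0 j) * `|c 0 j| ^+ 2.
    by rewrite -!quad uct {1}uc -KDK !mulmxA.
  have eqn : \sum_i `|u 0 i| ^+ 2 = \sum_j `|c 0 j| ^+ 2.
    by rewrite -!norm uct uc mulmxA -(mulmxA c) KK mulmx1.
  (* [u] and [c] have the same norm and the same quadratic form, so two sums of nonnegative terms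
     add up to zero and every term vanishes. *)
  have sum0 : \sum_i toC (D 0 i - x) * `|u 0 i| ^+ 2
            + \sum_j toC (x - E 0 j) * `|c 0 j| ^+ 2 = 0.
    under eq_bigr do rewrite rmorphB mulrBl.
    under [X in _ + X]eq_bigr do rewrite rmorphB mulrBl.
    rewrite !sumrB -!mulr_sumr eqq eqn; ring.
  have geD i : 0 <= toC (D 0 i - x) * `|u 0 i| ^+ 2.
    have [/u_out ->|] := boolP (a' i); first by rewrite normr0 expr0n mulr0.
    rewrite /a' /= -lteifNE => Dx; apply: mulr_ge0; rewrite ?exprn_ge0 //.
    by rewrite ler0c subr_ge0; apply: lteifW Dx.
  have geE j : 0 <= toC (x - E 0 j) * `|c 0 j| ^+ 2.
    have [|/c_out ->] := boolP (a j); last by rewrite normr0 expr0n mulr0.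
    rewrite /a /= => Dx; apply: mulr_ge0; rewrite ?exprn_ge0 //.
    by rewrite ler0c subr_ge0; apply: lteifW Dx.
  move/eqP: sum0; rewrite paddr_eq0; last 2 first.
  - by apply: sumr_ge0 => i _; exact: geD.
  - by apply: sumr_ge0 => i _; exact: geE.
  case/andP => /eqP sD0 /eqP sE0.
  have zero (z : R) (w : C) : z != 0 -> toC z * `|w| ^+ 2 = 0 -> w = 0.
    move=> z0 /eqP; rewrite mulf_eq0 fmorph_eq0 (negbTE z0) /= expf_eq0 /=.
    by rewrite normr_eq0 => /eqP.
  have D0 i : toC (D 0 i - x) * `|u 0 i| ^+ 2 = 0.
    exact: (psumr_eq0P (fun i _ => geD i) sD0).
  have E0 j : toC (x - E 0 j) * `|c 0 j| ^+ 2 = 0.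
    exact: (psumr_eq0P (fun i _ => geE i) sE0).
  (* Strictness sits on one side only. For [b] true, [D] exceeds [x] strictly off [a'], which kills
     [u]; for [b] false, [E] is strictly below [x] on [a], which kills [c]. *)
  move: c_out u_out; rewrite /a /a' /=; case: (b) => /= [_ u_out|c_out _].
    apply/rowP => i; rewrite [RHS]mxE; have [/u_out //|] := leP (D 0 i) x.
    by move=> xD; apply: (zero _ _ _ (D0 i)); rewrite subr_eq0 gt_eqF.
  suff c_0 : c = 0 by rewrite uc c_0 mul0mx.
  apply/rowP => i; rewrite [RHS]mxE; have [|] := ltP (E 0 i) x.
    by move=> xD; apply: (zero _ _ _ (E0 i)); rewrite subr_eq0 gt_eqF.
  by rewrite leNgt => /c_out.
have := rank_leq_col (X + Y)%MS; rewrite mxrank_disjoint_sum // rX rank_ind.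
by rewrite -[leqRHS]card_ord -(cardC a') leq_add2r.
Qed.

Lemma spectral_decomposition n (A : 'M[R]_n) : A^T = A ->
  exists (U : 'M[C]_n) (D : 'rV[R]_n),
    [/\ U *m U^t* = 1%:M, U^t* *m U = 1%:M,
        map_mx toC A = U^t* *m diag_mx (map_mx toC D) *m U &
        eigenvalues A = [seq D 0 i | i <- enum 'I_n]].
Proof.
move=> sA; set B := map_mx toC A.
have BH : B \is hermsymmx.
  apply/is_hermitianmxP; rewrite expr0 scale1r; apply/matrixP=> i j.
  have -> : B i j = toC (A^T i j) by rewrite sA mxE.
  by rewrite !mxE; apply/esym/conjc_real.
have /orthomx_spectralP := hermitian_normalmx BH.
have UU : spectralmx B *m (spectralmx B)^t* = 1%:M.
  exact/unitarymxP/spectral_unitarymx.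
rewrite invmx_unitary ?spectral_unitarymx // => defB.
exists (spectralmx B), (\row_i complex.Re (spectral_diag B 0 i)); split=> //.
- exact: mulmx1C.
- rewrite {1}defB; congr (_ *m diag_mx _ *m _); apply/rowP => i; rewrite !mxE.
  by apply/esym/RRe_real/mxOverP/hermitian_spectral_diag_real.
- by apply: eq_map => i; rewrite mxE.
Qed.

Lemma count_enum_ord n (a : pred R) (D : 'rV[R]_n) :
  count a [seq D 0 i | i <- enum 'I_n] = #|[pred i | a (D 0 i)]|.
Proof. by rewrite count_map -sum1_count big_enum_cond sum1_card. Qed.

Lemma trmx_compression m n (A : 'M[R]_n) (J : 'M[R]_(m, n)) :
  A^T = A -> (J *m A *m J^T)^T = J *m A *m J^T.
Proof. by move=> sA; rewrite !trmx_mul trmxK sA mulmxA. Qed.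

(** In the eigenbases of [A] and of its compression, [J] becomes a matrix [K] with orthonormal rows
    that compresses [D] to [E]. Upper half-lines are lower half-lines of the negated spectra. *)
Lemma count_eigenvalues_compression m n (A : 'M[R]_n) (J : 'M[R]_(m, n))
    (x : R) (b : bool) : A^T = A -> J *m J^T = 1%:M ->
  (count (fun y => y < x ?<= if b) (eigenvalues (J *m A *m J^T)) <=
     count (fun y => y < x ?<= if b) (eigenvalues A))%N /\
  (count (fun y => x < y ?<= if b) (eigenvalues (J *m A *m J^T)) <=
     count (fun y => x < y ?<= if b) (eigenvalues A))%N.
Proof.
move=> sA JJ.
have [U [D [UU' UU defA ->]]] := spectral_decomposition sA.
have [V [E [VV' VV defB ->]]] := spectral_decomposition (trmx_compression J sA).
pose K := V *m map_mx toC J *m U^t*.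
have conjJ : (map_mx toC J)^t* = map_mx toC (J^T).
  by apply/matrixP => i j; rewrite !mxE; exact: conjc_real.
have defK' : K^t* = U *m map_mx toC (J^T) *m V^t*.
  by rewrite /K !trmx_mul !map_mxM trmxCK conjJ mulmxA.
have KK : K *m K^t* = 1%:M.
  rewrite defK' /K !mulmxA -(mulmxA _ _ U) UU mulmx1 -(mulmxA V) -map_mxM JJ.
  by rewrite map_mx1 mulmx1.
have KDK : K *m diag_mx (map_mx toC D) *m K^t* = diag_mx (map_mx toC E).
  rewrite defK' /K !mulmxA -(mulmxA _ _ (diag_mx _)) -(mulmxA _ _ U) -defA.
  rewrite -!(mulmxA V) -!map_mxM defB !mulmxA VV' mul1mx.
  by rewrite -(mulmxA _ V) VV' mulmx1.
split; first by rewrite !count_enum_ord; exact: card_compression_le KK KDK.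
have KNK : K *m diag_mx (map_mx toC (- D)) *m K^t* = diag_mx (map_mx toC (- E)).
  have diagN p (w : 'rV[R]_p) :
      diag_mx (map_mx toC (- w)) = - diag_mx (map_mx toC w).
    by apply/matrixP => i j; rewrite !mxE rmorphN mulNrn.
  by rewrite !diagN mulmxN mulNmx KDK.
have := card_compression_le (- x) b KK KNK; rewrite !count_enum_ord.
have eq_neg p (w : 'rV[R]_p) : #|[pred j | (- w) 0 j < - x ?<= if b]| =
    #|[pred j | x < w 0 j ?<= if b]|.
  by apply: eq_card => j; rewrite !inE mxE lteifN2.
by rewrite !eq_neg.
Qed.

(** Cauchy interlacing. The first bound is compression on the closed lower half-line; the second is
    compression on the open upper one, read through complements among [n] and [n.+1] eigenvalues. *)
Lemma interlacing n (A : 'M[R]_n.+1) (J : 'M[R]_(n, n.+1)) (x : R) :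
    A^T = A -> J *m J^T = 1%:M ->
  (count (fun y => (y <= x)%R) (eigenvalues (J *m A *m J^T)) <=
     count (fun y => (y <= x)%R) (eigenvalues A) <=
       (count (fun y => (y <= x)%R) (eigenvalues (J *m A *m J^T))).+1)%N.
Proof.
move=> sA JJ; pose N k (B : 'M[R]_k) := count (fun y => y <= x) (eigenvalues B).
rewrite -!/(N _ _).
have [lo _] := count_eigenvalues_compression x true sA JJ.
have [_ hi] := count_eigenvalues_compression x false sA JJ.
apply/andP; split; first exact: lo.
have compl k (B : 'M[R]_k) :
    (N _ B + count (fun y => (x < y)%R) (eigenvalues B))%N = k.
  rewrite -[RHS](size_eigenvalues B) -(count_predC (fun y => (y <= x)%R)).
  by congr (_ + _)%N; apply: eq_count => y /=; rewrite ltNge.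
have := compl _ A; have := compl _ (J *m A *m J^T).
by move: hi => /=; lia.
Qed.

Lemma mup_char_poly n (A : 'M[R]_n) (gamma : R) : A^T = A ->
  mup gamma (char_poly A) = count_mem gamma (eigenvalues A).
Proof. by move=> sA; rewrite char_poly_eigenvalues // mu_prod_XsubC. Qed.

(** Symmetric matrices are diagonalizable, so multiplicity is corank; this lets ranks of blocks
    bound multiplicities. *)
Lemma count_mem_eigenvalues n (A : 'M[R]_n) (gamma : R) : A^T = A ->
  (count_mem gamma (eigenvalues A) + \rank (A - gamma%:M)%R = n)%N.
Proof.
move=> sA; have [U [D [UU' UU defA ->]]] := spectral_decomposition sA.
have Ufull : row_full (U^t*) by apply/row_fullP; exists U.
have Ufree : row_free U by apply/row_freeP; exists (U^t*).
rewrite -(mxrank_map toC) raddfB /= defA map_scalar_mx.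
have -> : (toC gamma)%:M = U^t* *m (toC gamma)%:M *m U.
  by rewrite mul_mx_scalar -scalemxAl UU scalemx1.
rewrite -mulmxBl -mulmxBr -diag_const_mx -raddfB /= -mulmxA.
rewrite (eqmxMfull _ Ufull) mxrankMfree // mxrank_diag count_enum_ord -[RHS]card_ord.
rewrite -(cardC [pred i | D 0 i == gamma]); congr (_ + _)%N.
apply: eq_card => i; rewrite !inE !mxE subr_eq0.
by rewrite (inj_eq (@complexI R)).
Qed.

End spectral_counting.

(** * Adjacency spectra of trees and tolls *)

(** The children are nested in a sequence, so their induction hypotheses come from an explicit
    fixpoint with an inner induction on that sequence. *)
Lemma ptree_children_ind (P : ptree -> Prop) :
  (forall ts : seq ptree, {in ts, forall t, P t} -> P (PNode ts)) ->
  forall t, P t.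
Proof.
move=> step; fix IH 1 => -[ts]; apply: step.
elim: ts => [s sn|t ts IHts s]; first by case: (notF sn).
by rewrite inE => /predU1P[-> | /IHts]; [exact: IH | exact].
Qed.

(** The non-root vertices of a node, with child indices starting at [k] instead of 0 so that
    induction on [ts] goes through. *)
Definition branches (k : nat) (ts : seq ptree) : seq (seq nat) :=
  flatten [seq [seq p.1 :: v | v <- p.2]
          | p <- zip (iota k (size ts)) (map vertices ts)].

Lemma vertices_node ts : vertices (PNode ts) = [::] :: branches 0 ts.
Proof. by []. Qed.

Lemma branches_cons k t ts :
  branches k (t :: ts) = map (cons k) (vertices t) ++ branches k.+1 ts.
Proof. by []. Qed.

Lemma mem_branches k ts v : (v \in branches k ts) =
  if v is i :: w then
    [&& (k <= i)%N, (i < k + size ts)%N &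
        w \in vertices (nth (PNode [::]) ts (i - k))]
  else false.
Proof.
elim: ts k v => [|t ts IH] k v.
  by rewrite in_nil; case: v => // i w; rewrite addn0; case: leqP => //=; lia.
rewrite branches_cons mem_cat IH /=; case: v => [|i w].
  by rewrite orbF; apply/mapP => -[].
have -> : (i :: w \in map (cons k) (vertices t)) = (i == k) && (w \in vertices t).
  apply/mapP/andP => [[w' w'V [-> ->]]|[/eqP -> wV]]; first by rewrite eqxx.
  by exists w.
case: (ltngtP k i) => [ki|ik|->] /=.
- by rewrite addSnnS -(subnSK ki).
- by [].
- by rewrite subnn orbF addnS ltnS leq_addr.
Qed.

Lemma uniq_branches k ts :
  {in ts, forall t, uniq (vertices t)} -> uniq (branches k ts).
Proof.
elim: ts k => // t ts IH k Uts; rewrite branches_cons cat_uniq.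
rewrite map_inj_uniq; last by move=> ? ? [].
rewrite Uts ?mem_head // IH ?andbT /=; last first.
  by move=> s sts; apply: Uts; rewrite inE sts orbT.
apply/hasPn => -[|i w]; rewrite mem_branches //= => /and3P[ki _ _].
by apply/mapP => -[v _ [ik _]]; rewrite ik ltnn in ki.
Qed.

Lemma uniq_vertices t : uniq (vertices t).
Proof.
elim/ptree_children_ind: t => ts IH; rewrite vertices_node /=.
by rewrite mem_branches uniq_branches.
Qed.

Lemma size_branches k ts :
  size (branches k ts) = (\sum_(t <- ts) size (vertices t))%N.
Proof.
elim: ts k => [|t ts IH] k; first by rewrite big_nil.
by rewrite branches_cons size_cat size_map IH big_cons.
Qed.

Lemma sum_vertices_node (M : nmodType) (g : ptree -> M) ts :
  \sum_(v <- vertices (PNode ts)) g (subtree (PNode ts) v) =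
  g (PNode ts) + \sum_(t <- ts) \sum_(v <- vertices t) g (subtree t v).
Proof.
rewrite vertices_node big_cons; congr (_ + _).
(* [subtree] looks children up in the whole list, so the induction runs over its suffixes. *)
suff gen us k : drop k us = ts ->
    \sum_(v <- branches k ts) g (subtree (PNode us) v) =
    \sum_(t <- ts) \sum_(v <- vertices t) g (subtree t v).
  by apply: gen; rewrite drop0.
elim: ts k => [|t ts IH] k dk; first by rewrite !big_nil.
have ltk : (k < size us)%N by rewrite ltnNge -subn_eq0 -size_drop dk.
move: dk; rewrite (drop_nth (PNode [::])) // => -[tk dk].
rewrite branches_cons big_cat big_cons (IH k.+1) //=; congr (_ + _).
by rewrite big_map; apply: eq_bigr => v _; rewrite -tk.
Qed.

Lemma adjacent_sym : symmetric adjacent.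
Proof. by move=> v w; rewrite /adjacent orbC. Qed.

Lemma adjacent_cons i j v w :
  adjacent (i :: v) (j :: w) = (i == j) && adjacent v w.
Proof.
rewrite /adjacent /= /parent /=.
case: v w => [|a v] [|b w] //=; rewrite ?eqseq_cons ?(eq_sym j i) ?andbF ?orbF //.
by case: (i == j); rewrite //= ?eqseq_cons.
Qed.

Section adjacency_spectrum.
Variable R : realType.
Implicit Types V W : seq (seq nat).

Local Notation cp V := (char_poly (adjacency_mx R V)).
Local Notation spec V := (eigenvalues (adjacency_mx R V)).

Lemma trmx_adjacency V : (adjacency_mx R V)^T = adjacency_mx R V.
Proof. by apply/matrixP => i j; rewrite !mxE adjacent_sym. Qed.

(** Restating the matrix over an equal dimension avoids transport along equalities of sizes. *)
Lemma char_poly_adjacency_size n V : size V = n ->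
  cp V = char_poly (\matrix_(i < n, j < n)
                      (adjacent (nth [::] V i) (nth [::] V j))%:R : 'M[R]_n).
Proof. by move=> <-. Qed.

Lemma char_poly_adjacency_map f V :
    {in V &, forall v w, adjacent (f v) (f w) = adjacent v w} ->
  cp (map f V) = cp V.
Proof.
move=> fV; rewrite (char_poly_adjacency_size (size_map f V)).
congr char_poly; apply/matrixP => i j; rewrite !mxE.
by rewrite !(nth_map [::]) // fV ?mem_nth.
Qed.

Lemma char_poly_adjacency_perm V W : perm_eq V W -> cp V = cp W.
Proof.
move=> VW; rewrite (char_poly_adjacency_size (perm_size VW)).
have /tuple_permP[s defV] : perm_eq V (in_tuple W) by [].
set A := \matrix_(_, _) _; set B := adjacency_mx R W.
have AB i j : A i j = B (s i) (s j).
  have nthV (k : 'I_(size W)) : nth [::] V k = nth [::] W (s k).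
    by rewrite defV -tnth_nth tnth_mktuple (tnth_nth [::]).
  by rewrite !mxE !nthV.
have -> : A = perm_mx s *m B *m perm_mx (s^-1)%g.
  by rewrite -row_permE -col_permE; apply/matrixP => i j; rewrite AB !mxE.
have polyM n (M N : 'M[R]_n) :
    map_mx polyC (M *m N) = map_mx polyC M *m map_mx polyC N.
  exact: map_mxM.
rewrite /char_poly /char_poly_mx.
set x : 'M[{poly R}]_(size W) := ('X)%:M.
(* Writing the scalar matrix too as a conjugate by the permutation lets both permutation factors
   leave the determinant. *)
have defx : x = map_mx polyC (perm_mx s) *m x *m map_mx polyC (perm_mx (s^-1)%g).
  rewrite mul_mx_scalar -scalemxAl -polyM -perm_mxM mulgV perm_mx1 map_mx1.
  by rewrite scalemx1.
rewrite {1}defx !polyM -mulmxBl -mulmxBr !det_mulmx mulrAC -det_mulmx -polyM.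
by rewrite -perm_mxM mulgV perm_mx1 map_mx1 det1 mul1r.
Qed.

Lemma char_poly_adjacency_bij (f g : seq nat -> seq nat) V W :
    uniq V -> uniq W ->
    {in V, forall v, f v \in W /\ g (f v) = v} ->
    {in W, forall w, g w \in V /\ f (g w) = w} ->
    {in V &, forall v w, adjacent (f v) (f w) = adjacent v w} ->
  cp V = cp W.
Proof.
move=> uV uW fV gW adj; rewrite -(char_poly_adjacency_map adj).
apply: char_poly_adjacency_perm; apply: uniq_perm => //.
  rewrite map_inj_in_uniq // => v w /fV[_ fv] /fV[_ fw] eqf.
  by rewrite -fv -fw eqf.
move=> w; apply/mapP/idP => [[v /fV[fv _] -> //]|/gW[gw fw]].
by exists (g w).
Qed.

Lemma char_poly_adjacency_cat V W :
    {in V & W, forall v w, ~~ adjacent v w} -> cp (V ++ W) = cp V * cp W.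
Proof.
move=> VW; rewrite (char_poly_adjacency_size (size_cat V W)).
rewrite (_ : \matrix_(_, _) _ = block_mx (adjacency_mx R V) 0 0 (adjacency_mx R W)).
  by rewrite /char_poly char_block_diag_mx det_ublock.
have nl (i : 'I_(size V)) : nth [::] (V ++ W) (lshift (size W) i) = nth [::] V i.
  by rewrite nth_cat /= ltn_ord.
have nr (i : 'I_(size W)) : nth [::] (V ++ W) (rshift (size V) i) = nth [::] W i.
  by rewrite nth_cat /= ltnNge leq_addr addKn.
apply/matrixP => i j.
case: (split_ordP i) => i' ->; case: (split_ordP j) => j' ->;
  rewrite ?(block_mxEul, block_mxEur, block_mxEdl, block_mxEdr) [LHS]mxE;
  rewrite ?(nl, nr) mxE //.
- by rewrite (negbTE (VW _ _ _ _)) ?mem_nth.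
- by rewrite adjacent_sym (negbTE (VW _ _ _ _)) ?mem_nth.
Qed.

Lemma char_poly_adjacency_nil : cp [::] = 1.
Proof. exact: det_mx00. Qed.

Lemma char_poly_branches k ts :
  cp (branches k ts) = \prod_(t <- ts) cp (vertices t).
Proof.
elim: ts k => [|t ts IH] k.
  by rewrite big_nil; exact: char_poly_adjacency_nil.
rewrite branches_cons big_cons char_poly_adjacency_cat ?IH; last first.
  move=> _ [|i w] /mapP[v _ ->]; rewrite mem_branches // => /and3P[ki _ _].
  by rewrite adjacent_cons ltn_eqF.
by rewrite char_poly_adjacency_map // => v w _ _; rewrite adjacent_cons eqxx.
Qed.

Lemma char_poly_forest_vertices ts :
  cp (forest_vertices ts) = \prod_(t <- ts) cp (vertices t).
Proof. exact: char_poly_branches. Qed.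

Lemma behead_vertices t : behead (vertices t) = branches 0 (children t).
Proof. by case: t. Qed.

(** This makes tolls well defined on isomorphism classes. The isomorphism fixes the root, hence
    restricts to the remaining vertices. *)
Lemma rooted_iso_char_poly t t' : rooted_iso t t' ->
  cp (vertices t) = cp (vertices t') /\
  cp (behead (vertices t)) = cp (behead (vertices t')).
Proof.
case=> f [g [fV gW f0 adj]]; split.
  exact: char_poly_adjacency_bij (uniq_vertices t) (uniq_vertices t') fV gW adj.
have memb s v : (v \in behead (vertices s)) = (v != [::]) && (v \in vertices s).
  case: s => ss; rewrite vertices_node inE /=.
  by case: eqVneq => [->|//]; rewrite mem_branches.
have root s : [::] \in vertices s by case: s => ss; rewrite vertices_node mem_head.
have g0 : g [::] = [::] by rewrite -{1}f0 (fV _ (root t)).2.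
apply: (char_poly_adjacency_bij (f := f) (g := g)).
- by have := uniq_vertices t; case: (vertices t) => //= ? ? /andP[].
- by have := uniq_vertices t'; case: (vertices t') => //= ? ? /andP[].
- move=> v; rewrite !memb => /andP[v0 /fV[fv gf]]; rewrite fv andbT; split=> //.
  by apply: contraNneq v0 => fv0; rewrite -gf fv0 g0.
- move=> v; rewrite !memb => /andP[v0 /gW[gv fg]]; rewrite gv andbT; split=> //.
  by apply: contraNneq v0 => gv0; rewrite -fg gv0 f0.
- by move=> v w; rewrite !memb => /andP[_ vV] /andP[_ wV]; exact: adj.
Qed.

(** Symmetric matrices have characteristic polynomials that split over the reals and so determine
    the eigenvalues with multiplicity. *)
Lemma spectrum_cat (V W X : seq (seq nat)) (a : pred R) : cp X = cp V * cp W ->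
  count a (spec X) = (count a (spec V) + count a (spec W))%N.
Proof.
rewrite !char_poly_eigenvalues ?trmx_adjacency // -big_cat /= => /prod_XsubC_eq.
by move=> /seq.permP ->; rewrite count_cat.
Qed.

Lemma eq_spectrum V W (a : pred R) : cp V = cp W ->
  count a (spec V) = count a (spec W).
Proof.
by rewrite !char_poly_eigenvalues ?trmx_adjacency // => /prod_XsubC_eq/seq.permP ->.
Qed.

Lemma count_spectrum_branches k ts (a : pred R) :
  count a (spec (branches k ts)) =
  (\sum_(t <- ts) count a (spec (vertices t)))%N.
Proof.
elim: ts k => [|t ts IH] k.
  have := size_eigenvalues (adjacency_mx R (branches k [::])).
  by rewrite big_nil => /size0nil ->.
rewrite big_cons -(IH k); apply: spectrum_cat.
by rewrite !char_poly_branches big_cons.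
Qed.

Definition toll (a : pred R) (t : ptree) : R :=
  (count a (spec (vertices t)))%:R - (count a (spec (behead (vertices t))))%:R.

Lemma rooted_iso_toll a t t' : rooted_iso t t' -> toll a t = toll a t'.
Proof.
move=> /rooted_iso_char_poly[e e']; rewrite /toll.
by congr (_%:R - _%:R); exact: eq_spectrum.
Qed.

(** The sum telescopes: a tree without its root has the spectra of its branches put together, and by
    induction these cancel the negative part of the toll. *)
Lemma sum_toll a t :
  \sum_(v <- vertices t) toll a (subtree t v) = (count a (spec (vertices t)))%:R.
Proof.
elim/ptree_children_ind: t => ts IH; rewrite sum_vertices_node.
rewrite {1}/toll behead_vertices count_spectrum_branches /= natr_sum.
by rewrite -[RHS]addr0 -addrA; congr (_ + _); rewrite (eq_big_seq _ IH) addNr.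
Qed.

Lemma toll_le_bound x t : 0 <= toll (fun y => y <= x) t <= 1.
Proof.
case: t => ts; rewrite /toll vertices_node /=; set V := branches 0 ts.
(* [J] selects the non-root coordinates, so compressing by it deletes the root from the adjacency
   matrix. *)
pose J : 'M[R]_(size V, (size V).+1) := \matrix_(i, j) (lift ord0 i == j)%:R.
have JJ : J *m J^T = 1%:M.
  apply/matrixP => i j; rewrite !mxE (bigD1 (lift ord0 i)) //=.
  rewrite big1 => [|k /negbTE ki].
    by rewrite !mxE eqxx mul1r addr0 (inj_eq lift_inj) eq_sym.
  by rewrite !mxE eq_sym ki mul0r.
have JAJ : J *m adjacency_mx R ([::] :: V) *m J^T = adjacency_mx R V.
  apply/matrixP => i j; rewrite !mxE (bigD1 (lift ord0 j)) //=.
  rewrite big1 => [|k /negbTE kj].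
    rewrite !mxE eqxx mulr1 addr0 (bigD1 (lift ord0 i)) //= big1 => [|k /negbTE ki].
      by rewrite !mxE eqxx mul1r addr0.
    by rewrite !mxE eq_sym ki mul0r.
  by rewrite !mxE eq_sym kj mulr0.
have := interlacing x (trmx_adjacency ([::] :: V)) JJ; rewrite JAJ.
move=> /andP[lo hi]; rewrite subr_ge0 ler_nat lo /= lerBlDl.
by rewrite natr1 ler_nat.
Qed.

End adjacency_spectrum.

(** * Eigenvectors vanishing at the root *)

Lemma size_vertices_node ts :
  size (vertices (PNode ts)) = (\sum_(t <- ts) size (vertices t))%N.+1.
Proof. by rewrite vertices_node /= size_branches. Qed.

Lemma count_vertices_node (a : pred ptree) ts :
  (\sum_(v <- vertices (PNode ts)) a (subtree (PNode ts) v) =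
   a (PNode ts) + \sum_(t <- ts) \sum_(v <- vertices t) a (subtree t v))%N.
Proof. exact: (sum_vertices_node (fun t => a t : nat)). Qed.

Section eigenspace_rank.
Variables (R : realType) (gamma : R).
Implicit Types V W : seq (seq nat).

Local Notation spec V := (eigenvalues (adjacency_mx R V)).

Definition shifted_adjacency (v w : seq nat) : R :=
  (adjacent v w)%:R - gamma *+ (v == w).

(** A left kernel vector of this block is a vector supported on [V] whose image under the adjacency
    operator minus [gamma] vanishes on [W]. *)
Definition adjacency_rank V W : nat :=
  \rank (\matrix_(i < size V, j < size W)
           shifted_adjacency (nth [::] V i) (nth [::] W j)).

Local Notation rk := adjacency_rank.

Lemma adjacency_rank_size m n V W : size V = m -> size W = n ->
  rk V W = \rank (\matrix_(i < m, j < n)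
                    shifted_adjacency (nth [::] V i) (nth [::] W j)).
Proof. by move=> <- <-. Qed.

Lemma adjacency_rank_leq_row V W : (rk V W <= size V)%N.
Proof. exact: rank_leq_row. Qed.

Lemma adjacency_rank_leq_col V W : (rk V W <= size W)%N.
Proof. exact: rank_leq_col. Qed.

Lemma adjacency_rank_map f V W :
    {in V & W, forall v w,
      shifted_adjacency (f v) (f w) = shifted_adjacency v w} ->
  rk (map f V) (map f W) = rk V W.
Proof.
move=> fVW; rewrite (adjacency_rank_size (size_map f V) (size_map f W)).
congr mxrank; apply/matrixP => i j; rewrite !mxE !(nth_map [::]) //.
by rewrite fVW ?mem_nth.
Qed.

Lemma adjacency_rank_catl V V' W : (rk (V ++ V') W <= rk V W + rk V' W)%N.
Proof.
rewrite (adjacency_rank_size (size_cat V V') erefl).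
set A := \matrix_(_, _) _; rewrite -(vsubmxK A) -addsmxE.
apply: leq_trans (mxrank_adds_leqif _ _) _; rewrite leq_eqVlt; apply/orP; left.
apply/eqP; congr (_ + _)%N; congr mxrank; apply/matrixP => i j;
  rewrite !mxE nth_cat /=.
  by rewrite ltn_ord.
by rewrite ltnNge leq_addr addKn.
Qed.

Lemma adjacency_rank_sub_col V W W' :
    {in W, forall w, w \in W' \/
      {in V, forall v, shifted_adjacency v w = 0}} ->
  (rk V W <= rk V W')%N.
Proof.
move=> sW; set A := \matrix_(i < size V, j < size W')
  shifted_adjacency (nth [::] V i) (nth [::] W' j).
(* [S] picks for each label of [W] the equally labelled column of [W'], and is zero where there is
   none. *)
pose S : 'M[R]_(size W', size W) := \matrix_(k, j)
  ((nth [::] W j \in W') && (k == index (nth [::] W j) W' :> nat))%:R.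
rewrite /rk (_ : \matrix_(_, _) _ = A *m S); first exact: mxrankM_maxl.
apply/matrixP => i j; rewrite !mxE; set w := nth [::] W j.
have [wW'|wW'] := boolP (w \in W'); last first.
  have [//|wV] := sW w (mem_nth _ (ltn_ord j)); first by rewrite (negbTE wW').
  rewrite wV ?mem_nth // big1 // => k _.
  by rewrite !mxE -/w (negbTE wW') mulr0.
have lt_w : (index w W' < size W')%N by rewrite index_mem.
rewrite (bigD1 (Ordinal lt_w)) //= big1 ?addr0 => [|k kw].
  by rewrite !mxE -/w wW' /= eqxx mulr1 nth_index.
rewrite !mxE -/w wW' /= (negbTE (_ : (k : nat) != index w W')) ?mulr0 //.
Qed.

Lemma adjacency_rank_catr V W W' :
  (rk V (W ++ W') <= rk V W + rk V W')%N.
Proof.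
rewrite (adjacency_rank_size erefl (size_cat W W')).
set A := \matrix_(_, _) _; rewrite -(hsubmxK A) -mxrank_tr tr_row_mx -addsmxE.
apply: leq_trans (mxrank_adds_leqif _ _) _; rewrite !mxrank_tr.
rewrite leq_eqVlt; apply/orP; left.
apply/eqP; congr (_ + _)%N; congr mxrank; apply/matrixP => i j;
  rewrite !mxE nth_cat /=.
  by rewrite ltn_ord.
by rewrite ltnNge leq_addr addKn.
Qed.

Lemma adjacency_rank_spectrum V : uniq V ->
  (count_mem gamma (spec V) + rk V V = size V)%N.
Proof.
move=> uV; rewrite -[RHS](count_mem_eigenvalues gamma (trmx_adjacency R V)).
congr (_ + \rank _)%N; apply/matrixP => i j; rewrite !mxE /shifted_adjacency.
by rewrite nth_uniq.
Qed.

(* An extra vertex adjacent to the root only is kept as a column, so the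
   corank counts the eigenvectors that vanish at the root; these extend by zero
   to any larger tree. *)
Definition planted_rank (t : ptree) : nat :=
  rk (map (cons 0%N) (vertices t)) ([::] :: map (cons 0%N) (vertices t)).

Lemma shifted_adjacency_cons i v w :
  shifted_adjacency (i :: v) (i :: w) = shifted_adjacency v w.
Proof. by rewrite /shifted_adjacency adjacent_cons eqseq_cons eqxx. Qed.

(** For the branch at child [k], the parent [[::]] plays the part of the extra vertex, and the value
    of [k] is immaterial. *)
Lemma planted_rank_shift k t :
  rk (map (cons k) (vertices t)) ([::] :: map (cons k) (vertices t)) =
  planted_rank t.
Proof.
pose f (v : seq nat) := if v is _ :: w then k :: w else [::].
have -> : map (cons k) (vertices t) = map f (map (cons 0%N) (vertices t)).
  by rewrite -map_comp.
apply: (adjacency_rank_map (f := f) (W := [::] :: _)).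
move=> _ w /mapP[v _ ->]; rewrite inE => /predU1P[->|/mapP[w' _ ->]] /=.
  by rewrite /shifted_adjacency /Defs.adjacent /parent /=; case: v.
by rewrite !shifted_adjacency_cons.
Qed.

(** Rows of one branch are nonzero only in the columns of that branch and of the common parent, so
    the block splits into planted blocks. *)
Lemma rank_branches_le k us ts : drop k us = ts ->
  (rk (branches k ts) ([::] :: branches 0 us) <=
     \sum_(t <- ts) planted_rank t)%N.
Proof.
elim: ts k => [|t ts IH] k dk.
  by rewrite big_nil; exact: adjacency_rank_leq_row.
have ltk : (k < size us)%N by rewrite ltnNge -subn_eq0 -size_drop dk.
move: dk; rewrite (drop_nth (PNode [::])) // => -[tk dk].
rewrite branches_cons big_cons.
apply: leq_trans (adjacency_rank_catl _ _ _) _; apply: leq_add; last exact: IH.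
rewrite -(planted_rank_shift k); apply: adjacency_rank_sub_col => w.
rewrite inE => /predU1P[->|]; first by left; rewrite mem_head.
rewrite mem_branches; case: w => // i w; rewrite subn0 => /and3P[_ _ wt].
have [ik|ik] := eqVneq i k.
  by left; rewrite inE ik; apply/mapP; exists w => //; rewrite -tk -ik.
right=> _ /mapP[v _ ->]; rewrite /shifted_adjacency adjacent_cons eqseq_cons.
by rewrite eq_sym (negbTE ik) subr0.
Qed.

(** The row of the root costs at most 1, and no other row meets the column of the extra vertex. *)
Lemma planted_rank_node ts :
  (planted_rank (PNode ts) <= 1 + rk (branches 0 ts) ([::] :: branches 0 ts))%N.
Proof.
rewrite /planted_rank; set W := _ :: _.
rewrite vertices_node map_cons -cat1s.
apply: leq_trans (adjacency_rank_catl _ _ _) _; apply: leq_add.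
  exact: adjacency_rank_leq_row.
rewrite -(@adjacency_rank_map (cons 0%N) (branches 0 ts)); last first.
  by move=> v w _ _; exact: shifted_adjacency_cons.
apply: adjacency_rank_sub_col => w; rewrite /W vertices_node map_cons !inE.
case/predU1P=> [->|]; last by left.
right=> _ /mapP[[|i v] vb ->]; first by rewrite mem_branches in vb.
by rewrite /shifted_adjacency /Defs.adjacent /parent /= subr0.
Qed.

(** In corank form: the eigenvectors for [gamma] that vanish at the root form a space of dimension
    at least the number of subtrees marked by [a]. *)
Lemma planted_rank_add_count (a : pred ptree) (N : nat) t :
    (forall s, a s -> size (vertices s) = N) ->
    (forall s, a s ->
       (1 < count_mem gamma (spec (branches 0 (children s))))%N) ->
  (planted_rank t + \sum_(v <- vertices t) a (subtree t v) <=
     size (vertices t))%N.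
Proof.
move=> aN a_mult.
(* Marked subtrees all have [N] vertices, so none is properly contained in another. *)
have small s : (size (vertices s) < N)%N ->
    (\sum_(v <- vertices s) a (subtree s v) = 0)%N.
  elim/ptree_children_ind: s => ts IH; rewrite size_vertices_node.
  move=> ltN; rewrite count_vertices_node.
  rewrite (_ : a (PNode ts) = false); last first.
    apply/negP => /aN; rewrite size_vertices_node.
    by move=> eqN; move: ltN; rewrite eqN ltnn.
  rewrite add0n big1_seq // => s /= s_ts; apply: IH => //.
  apply: leq_ltn_trans ltN; apply: leqW.
  by rewrite (big_rem s) //= leq_addr.
elim/ptree_children_ind: t => ts IH.
rewrite count_vertices_node size_vertices_node.
(* At a marked root there is just one subtree to count. The row and the column of the root raise the
   rank by at most 2 over that of the branches, whose corank is at least 2; the vertices exceed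
   those of the branches by 1, so a corank of at least 1 remains. *)
have [aT|_] := boolP (a (PNode ts)).
  rewrite [X in (_ + (_ + X))%N]big1_seq; last first.
    move=> s /= s_ts; apply: small; rewrite -(aN _ aT) size_vertices_node ltnS.
    by rewrite (big_rem s) //= leq_addr.
  have := a_mult _ aT; have := planted_rank_node ts.
  have := adjacency_rank_spectrum
    (uniq_branches 0 (fun t _ => uniq_vertices t) (ts := ts)).
  have := adjacency_rank_catr (branches 0 ts) [:: [::]] (branches 0 ts).
  have := adjacency_rank_leq_col (branches 0 ts) [:: [::]].
  have := size_branches 0 ts; rewrite addn0 /=; lia.
(* At an unmarked root the extra row is paid for by the extra vertex, and the bounds for the
   branches add up. *)
have := planted_rank_node ts; have := rank_branches_le (drop0 ts).
have : (\sum_(t <- ts) planted_rank t +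
    \sum_(t <- ts) \sum_(v <- vertices t) a (subtree t v) <=
    \sum_(t <- ts) size (vertices t))%N.
  rewrite -big_split /= !big_seq; exact: leq_sum.
by rewrite add0n; lia.
Qed.

(** Dropping the column of the extra vertex can only lower the rank, that is, enlarge the
    eigenspace. *)
Lemma count_subtrees_le_multiplicity (a : pred ptree) (N : nat) t :
    (forall s, a s -> size (vertices s) = N) ->
    (forall s, a s ->
       (1 < count_mem gamma (spec (branches 0 (children s))))%N) ->
  (\sum_(v <- vertices t) a (subtree t v) <=
     count_mem gamma (spec (vertices t)))%N.
Proof.
move=> aN a_mult; have := planted_rank_add_count t aN a_mult.
have := adjacency_rank_spectrum (uniq_vertices t).
suff : (rk (vertices t) (vertices t) <= planted_rank t)%N by lia.
rewrite -(@adjacency_rank_map (cons 0%N)); last first.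
  by move=> v w _ _; exact: shifted_adjacency_cons.
by apply: adjacency_rank_sub_col => w wV; left; rewrite inE wV orbT.
Qed.

End eigenspace_rank.

(** * Integrals of bounded functions *)

Lemma continuous_borel_measurable (E : ptopologicalType) (R : realType)
    (f : E -> R) :
  continuous f -> measurable_fun setT (f : borel E -> R).
Proof.
move=> /continuousP cf.
apply: (measurability _ (RGenOpens.measurableE R)).
move=> _ [_ [a [b ->] <-]]; rewrite setTI; apply: sub_sigma_algebra.
exact/cf/interval_open.
Qed.

Lemma indic_bound (T : Type) (R : realType) (A : set T) x :
  `|\1_A x : R| <= 1.
Proof. by rewrite indicE; case: (x \in A); rewrite ?normr1 ?normr0. Qed.

Section bounded_integrals.
Context d (T : measurableType d) (R : realType) (P : probability T R).
Implicit Types (f g : T -> R) (M : R).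

Lemma bounded_integrable f M : measurable_fun setT f ->
  (forall x, `|f x| <= M) -> P.-integrable setT (EFin \o f).
Proof.
move=> mf fM; apply: measurable_bounded_integrable => //.
  by rewrite ltey_eq fin_num_measure.
exists M; split; first exact: num_real.
by move=> N MN x _; apply: le_trans (fM x) (ltW MN).
Qed.

Lemma Rintegral_cst1 (k : R) : \int[P]_x k = k.
Proof. by rewrite Rintegral_cst //= probability_setT mulr1. Qed.

Lemma Rintegral_sub_cst f M k : measurable_fun setT f ->
  (forall x, `|f x| <= M) -> \int[P]_x (f x - k) = \int[P]_x f x - k.
Proof.
move=> mf fM; rewrite -[in RHS](Rintegral_cst1 k) -RintegralB //.
  exact: bounded_integrable mf fM.
exact: finite_measure_integrable_cst.
Qed.

Lemma Rintegral_bound f M : measurable_fun setT f ->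
  (forall x, `|f x| <= M) -> `|\int[P]_x f x| <= M.
Proof.
move=> mf fM; have intf := bounded_integrable mf fM.
apply: le_trans (le_normr_Rintegral measurableT intf) _.
rewrite -[leRHS]Rintegral_cst1; apply: le_Rintegral => //.
- apply: (@bounded_integrable _ M); first exact: measurableT_comp.
  by move=> x; rewrite normr_id.
- exact: finite_measure_integrable_cst.
Qed.

Lemma Rintegral_indic (A : set T) : measurable A ->
  \int[P]_x (\1_A x : R) = fine (P A).
Proof. by move=> mA; rewrite /Rintegral integral_indic // setIT. Qed.

Lemma bounded_convergence (f_ : nat -> T -> R) f M :
    (forall n, measurable_fun setT (f_ n)) -> measurable_fun setT f ->
    (forall n x, `|f_ n x| <= M) -> (forall x, f_ ^~ x @ \oo --> f x) ->
  (fun n => \int[P]_x f_ n x) @ \oo --> \int[P]_x f x.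
Proof.
move=> mf_ mf f_M f_f.
have [| | | | |intf _ cvgI] := @dominated_convergence _ _ _ P _ measurableT
  (fun n x => (f_ n x)%:E) (fun x => (f x)%:E) (cst M%:E).
- by move=> n; exact/measurable_EFinP.
- exact/measurable_EFinP.
- by apply: aeW => x _; apply: cvg_EFin; [exact: nearW|exact: f_f].
- exact: finite_measure_integrable_cst.
- by apply: aeW => x n _ /=; rewrite lee_fin.
rewrite /Rintegral; apply: fine_cvg; rewrite fineK //.
exact: (integrable_fin_num measurableT intf).
Qed.

End bounded_integrals.

Section empirical_integrals.
Context d (T : measurableType d) (R : realType).
Variables (s : seq T) (s_gt0 : (0 < size s)%N).

Let mu : probability T R := empirical R s_gt0.

Lemma Rintegral_empirical (f : T -> R) M : measurable_fun setT f ->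
    (forall x, `|f x| <= M) ->
  \int[mu]_x f x = (size s)%:R^-1 * \sum_(x <- s) f x.
Proof.
move=> mf fM.
have M0 : 0 <= M by case: s s_gt0 => // x _ _; exact: le_trans (normr_ge0 _) (fM x).
(* The shift by [M] makes the integrand nonnegative, as the formulas for scaled and summed measures
   require. *)
pose g x := f x + M.
have mg : measurable_fun setT g by apply: measurable_funD.
have g0 x : 0 <= g x.
  by rewrite /g -lerBlDr sub0r; have := fM x; rewrite ler_norml => /andP[].
have gM x : `|g x| <= M + M.
  rewrite /g; apply: le_trans (ler_normD _ _) _; apply: lerD => //.
  by rewrite ger0_norm.
have intg : \int[mu]_x g x = (size s)%:R^-1 * \sum_(x <- s) g x.
  rewrite /Rintegral /mu /empirical ge0_integral_mscale //=; last first.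
  - by move=> x _; rewrite lee_fin.
  - exact/measurable_EFinP.
  rewrite ge0_integral_measure_sum //=; last first.
  - exact/measurable_EFinP.
  - by move=> x _; rewrite lee_fin.
  under eq_bigr => i _.
    rewrite integral_dirac //; last exact/measurable_EFinP.
    rewrite diracT mul1e; over.
  rewrite sumEFin /=; congr (_ * _).
  by rewrite [RHS](big_nth point) big_mkord.
have -> : \int[mu]_x f x = \int[mu]_x g x - M.
  rewrite -(Rintegral_sub_cst mu M mg gM); apply: eq_Rintegral => x _.
  by rewrite /g addrK.
rewrite intg /g big_split /= mulrDr.
rewrite big_const_seq count_predT iter_addr_0 -[M *+ _]mulr_natl mulrA mulVf.
  by rewrite mul1r addrK.
by rewrite pnatr_eq0 -lt0n.
Qed.

Lemma fine_empirical (A : set T) : measurable A ->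
  fine (mu A) = (size s)%:R^-1 * \sum_(x <- s) \1_A x.
Proof.
move=> mA; rewrite -Rintegral_indic //.
by apply: (@Rintegral_empirical _ 1) => // x; exact: indic_bound.
Qed.

End empirical_integrals.

(** * Spectral masses as integrals under [Phi] *)

Section spectral_distribution_formulas.
Variable R : realType.
Implicit Types (t : utree) (a : pred R).

Definition utree_toll a t : R := toll a (repr t).

Lemma repr_iso_class (t : ptree) : rooted_iso (repr (iso_class t)) t.
Proof. by apply/asboolP; have /eqmodP := reprK (iso_class t). Qed.

Lemma utree_toll_iso_class a (t : ptree) : utree_toll a (iso_class t) = toll a t.
Proof. exact: rooted_iso_toll (repr_iso_class t). Qed.

Lemma discrete_continuous (T : discreteTopologicalType) (E : topologicalType)
  (f : T -> E) : continuous f.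
Proof. by apply/continuousP => A _; exact: discrete_open. Qed.

(** The value 0 is a mere default: [spine_seq] and [sin_star] never have the adjoined point as first
    coordinate. *)
Definition root_function (f : utree -> R) (s : star_seq) : R :=
  if s 0%N is Some t then f t else 0.

Lemma continuous_root_function f : continuous (root_function f).
Proof.
pose g (o : utree_star) : R := if o is Some t then f t else 0.
have projC : continuous (fun s : star_seq => s 0%N) by exact: proj_continuous.
have gC : continuous g by exact: discrete_continuous.
move=> s; apply: (@continuous_comp _ _ _ (fun s : star_seq => s 0%N) g).
  exact: projC.
exact: gC.
Qed.

Lemma Rintegral_Phi (f : utree -> R) M t : (forall t, `|f t| <= M) ->
  \int[Phi R t]_s root_function f s =
  (size (vertices (repr t)))%:R^-1 *
    \sum_(v <- vertices (repr t)) f (iso_class (subtree (repr t) v)).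
Proof.
move=> fM; rewrite (@Rintegral_empirical _ _ _ _ _ _ (`|M|)).
- by rewrite size_map big_map.
- apply: (@continuous_borel_measurable star_seq R).
  exact: continuous_root_function.
- move=> s; rewrite /root_function; case: (s 0%N) => [u|].
    by apply: le_trans (fM u) _; exact: ler_norm.
  by rewrite normr0 normr_ge0.
Qed.

(** By [sum_toll]. Compared with [Rintegral_Phi], the right-hand side is the integral under [Phi] of
    the toll of the first coordinate. *)
Lemma fine_spectral_distribution t (A : set (borel R)) (a : pred R) :
    measurable A -> (forall x, A x <-> a x) ->
  fine (spectral_distribution R t A) =
  (size (vertices (repr t)))%:R^-1 *
    \sum_(v <- vertices (repr t)) utree_toll a (iso_class (subtree (repr t) v)).
Proof.
move=> mA Aa; rewrite fine_empirical // size_eigenvalues.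
congr (_ * _); under [RHS]eq_bigr do rewrite utree_toll_iso_class.
rewrite sum_toll -sum1_count natr_sum [RHS]big_mkcond /=; apply: eq_bigr => x _.
rewrite indicE; case: ifP => ax; first by rewrite mem_set //; apply/Aa.
by rewrite memNset // => /Aa; rewrite ax.
Qed.

End spectral_distribution_formulas.

(** * Convergence in probability *)

Section convergence_in_probability.
Variables (R : realType) (d : nat -> measure_display).
Variables (Omega : forall n, measurableType (d n)).
Variables (P : forall n, probability (Omega n) R).
Variables (T : forall n, {RV (P n) >-> borel utree}).

Lemma measurable_preimage_utree n (A : set utree) : measurable (T n @^-1` A).
Proof.
by apply: measurable_funPTI; apply: sub_sigma_algebra; exact: discrete_open.
Qed.

Lemma measurable_fun_utree n (f : utree -> R) :
  measurable_fun setT (fun w => f (T n w)).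
Proof.
by move=> _ B mB; rewrite setTI; exact: (measurable_preimage_utree n (f @^-1` B)).
Qed.

(* [phi @ likely_trees --> c] says that [phi (T n)] tends to [c] in
   probability. *)
Definition likely_trees : set_system utree :=
  [set U | (fun n => P n (T n @^-1` (~` U))) @ \oo --> 0%E].

(** Being a filter gives convergence in probability the usual calculus of limits. Intersections use
    subadditivity; properness holds because the whole space has probability 1. *)
Global Instance likely_trees_filter : ProperFilter likely_trees.
Proof.
split; last first.
  split.
  - rewrite /likely_trees /=; under eq_fun do rewrite setCT preimage_set0 measure0.
    exact: cvg_cst.
  - move=> U V PU PV; rewrite /likely_trees /=.
    apply: (@squeeze_cvge _ _ _ _ (cst 0%E) _
      (fun n => P n (T n @^-1` (~` U)) + P n (T n @^-1` (~` V)))%E).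
    + apply: nearW => n; rewrite measure_ge0 /= setCI preimage_setU.
      by apply: measureU2; exact: measurable_preimage_utree.
    + exact: cvg_cst.
    + by rewrite -[X in _ --> X]adde0; apply: cvgeD.
  - move=> U V UV PU; apply: (@squeeze_cvge _ _ _ _ (cst 0%E) _
      (fun n => P n (T n @^-1` (~` U)))).
    + apply: nearW => n; rewrite measure_ge0 /=; apply: le_measure;
        rewrite ?inE; try exact: measurable_preimage_utree.
      by apply: preimage_subset; exact: subsetC.
    + exact: cvg_cst.
    + exact: PU.
rewrite /likely_trees /= => P0.
have P1 : (fun n => P n (T n @^-1` (~` set0))) @ \oo --> 1%E.
  under eq_fun do rewrite setC0 preimage_setT probability_setT.
  exact: cvg_cst.
have e01 : 0%E = 1%E :> \bar R := cvg_unique _ P0 P1.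
by have /eqP := @onee_neq0 R; rewrite -e01.
Qed.

Lemma likely_treesP (U : set utree) : likely_trees U <->
  (fun n => fine (P n (T n @^-1` (~` U)))) @ \oo --> (0 : R).
Proof.
rewrite /likely_trees /=; split => [|cvgU]; first exact: fine_cvg.
apply/fine_cvgP; split; last exact: cvgU.
by apply: nearW => n; rewrite fin_num_measure //; exact: measurable_preimage_utree.
Qed.

Lemma integrable_utree n (f : utree -> R) M : (forall t, `|f t| <= M) ->
  (P n).-integrable setT (EFin \o (fun w => f (T n w))).
Proof.
move=> fM; apply: (@bounded_integrable _ _ _ _ _ M) => [|w]; last exact: fM.
exact: measurable_fun_utree.
Qed.

Lemma Rintegral_utree_indic n (A : set utree) :
  \int[P n]_w (\1_A (T n w) : R) = fine (P n (T n @^-1` A)).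
Proof.
by rewrite -Rintegral_indic //; exact: measurable_preimage_utree.
Qed.

(** Markov's inequality. *)
Lemma cvg_in_mean_likely (X : utree -> R) (c M : R) :
    (forall t, `|X t - c| <= M) ->
    (fun n => \int[P n]_w `|X (T n w) - c|) @ \oo --> (0 : R) ->
  X @ likely_trees --> c.
Proof.
move=> XM X0; apply/cvgrPdist_lt => e e0; apply/likely_treesP.
set A := ~` _; have XM' t : `| `|X t - c| | <= M by rewrite normr_id.
apply: (@squeeze_cvgr _ _ _ _ (cst 0)
  (fun n => e^-1 * \int[P n]_w `|X (T n w) - c|)).
- apply: nearW => n; rewrite fine_ge0 ?measure_ge0 //= mulrC ler_pdivlMr //.
  rewrite -Rintegral_utree_indic -RintegralZr //; last first.
    apply: (@integrable_utree n (\1_A) 1) => t; exact: indic_bound.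
  apply: le_Rintegral => //.
  + apply: (@integrable_utree n (fun t => \1_A t * e) e) => t.
    by rewrite normrM (gtr0_norm e0) ler_piMl ?indic_bound // ltW.
  + exact: (integrable_utree n (f := fun t => `|X t - c|) XM').
  move=> w _; rewrite indicE; case: (boolP (_ \in _)) => [|_].
    by rewrite inE mul1r /A /= distrC => /negP; rewrite -leNgt.
  by rewrite mul0r.
- exact: cvg_cst.
- by rewrite -[X in _ --> X](mulr0 e^-1); apply: cvgMr.
Qed.

Lemma likely_cvg_in_distribution (E : topologicalType) (phi : utree -> E) (c : E) :
    phi @ likely_trees --> c ->
  cvg_in_distribution P (fun n w => phi (T n w)) c.
Proof.
move=> phic g gc [M gM].
have gphi : (g \o phi) @ likely_trees --> g c.
  by apply: cvg_comp phic _; exact: gc.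
have M0 : 0 <= M by exact: le_trans (normr_ge0 _) (gM c).
apply/cvgrPdist_lt => e e0.
have e2 : 0 < e / 2 by rewrite divr_gt0.
move/cvgrPdist_lt: gphi => /(_ _ e2) /likely_treesP.
set A := ~` _ => /cvgrPdist_lt.
(* The summand 1 keeps the divisor positive when [M] is 0. *)
have e3 : 0 < e / 2 / (M + M + 1) by rewrite divr_gt0 // ltr_wpDl // addr_ge0.
move=> /(_ _ e3); apply: filterS => n; rewrite sub0r normrN => PA.
have psiM t : `|g (phi t)| <= M by exact: gM.
have difM t : `|g (phi t) - g c| <= M + M.
  by apply: le_trans (ler_normB _ _) _; exact: lerD.
rewrite distrC -(Rintegral_sub_cst (P n) (g c) (@measurable_fun_utree n (g \o phi))
  (fun w => psiM (T n w))).
(* Off the unlikely set [A] the integrand is at most [e / 2]; on it, at most [M + M]. *)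
apply: le_lt_trans (_ : e / 2 + (M + M) * fine (P n (T n @^-1` A)) < e); last first.
  rewrite [ltRHS]splitr ltrD2l; apply: le_lt_trans
    (_ : (M + M) * (e / 2 / (M + M + 1)) < _).
    rewrite ler_wpM2l ?addr_ge0 //; apply: le_trans (ltW PA); exact: ler_norm.
  rewrite mulrCA -[ltRHS]mulr1 ltr_pM2l // ltr_pdivrMr; first by rewrite mul1r ltrDl.
  by rewrite ltr_wpDl // addr_ge0.
apply: le_trans (le_normr_Rintegral measurableT
  (integrable_utree n (f := fun t => g (phi t) - g c) difM)) _.
rewrite -Rintegral_utree_indic -RintegralZl //; last first.
  by apply: (@integrable_utree n (\1_A) 1) => t; exact: indic_bound.
rewrite -[X in X + _](Rintegral_cst1 (P n)) -RintegralD //; last 2 first.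
- exact: finite_measure_integrable_cst.
- apply: (@integrable_utree n (fun t => (M + M) * \1_A t) (M + M)) => t.
  by rewrite normrM ger0_norm ?addr_ge0 // ler_piMr ?addr_ge0 // indic_bound.
apply: le_Rintegral => //.
- apply: (@integrable_utree n (fun t => `|g (phi t) - g c|) (M + M)) => t.
  by rewrite normr_id.
- apply: (@integrable_utree n (fun t => e / 2 + (M + M) * \1_A t)
    (e / 2 + (M + M))) => t.
  apply: le_trans (ler_normD _ _) _; rewrite gtr0_norm // lerD2l.
  by rewrite normrM ger0_norm ?addr_ge0 // ler_piMr ?addr_ge0 // indic_bound.
move=> w _; rewrite indicE; case: (boolP (_ \in _)) => [_|].
  by rewrite mulr1 (le_trans (difM _)) // lerDr ltW.
rewrite mulr0 addr0 notin_setE /A /= => /contrapT; rewrite distrC; exact: ltW.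
Qed.

End convergence_in_probability.

(** * Weak convergence from distribution functions *)

Section weak_convergence_from_cdf.
Variable R : realType.
Implicit Types (f : R -> R) (mu : probability (borel R) R).

(** Heine-Cantor through the near-covering form of compactness. Only [x] is confined to the segment:
    grid cells may overshoot its right end. *)
Lemma continuous_segment_uniform f (a b e : R) : continuous f -> 0 < e ->
  exists2 delta : R, 0 < delta &
    forall x y, a <= x <= b -> `|x - y| < delta -> `|f x - f y| < e.
Proof.
move=> cf e0; have e2 : 0 < e / 2 by rewrite divr_gt0.
pose good (delta : R) x := forall y, `|x - y| < delta -> `|f x - f y| < e.
have cov : near_covering `[a, b]%classic.
  exact/compact_near_coveringP/segment_compact.
have loc x : `[a, b]%classic x ->
    \forall x' \near x & delta \near (0 : R)^'+, good delta x'.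
  move=> _; have /cvgrPdist_lt/(_ _ e2) := cf x.
  move=> /nbhs_ballP[r /= r0 rx]; have r2 : 0 < r / 2 by rewrite divr_gt0.
  near=> x' delta => y yx'.
  have x'x : `|x - x'| < r / 2 by near: x'; exact: nbhsx_ballx.
  have deltar : delta < r / 2 by near: delta; exact: nbhs_right_lt.
  have fx' : `|f x - f x'| < e / 2.
    by apply: rx; apply: lt_trans x'x _; rewrite ltr_pdivrMr // ltr_pMr // ltr1n.
  have fy : `|f x - f y| < e / 2.
    apply: rx; rewrite /ball /= [r]splitr -(subrKA x').
    rewrite (le_lt_trans (ler_normD _ _)) //.
    by rewrite ltrD // (lt_trans yx').
  rewrite [e]splitr -(subrKA (f x)) (le_lt_trans (ler_normD _ _)) // ltrD //.
  by rewrite distrC.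
have near_good : \forall delta \near (0 : R)^'+,
    (`[a, b]%classic `<=` good delta) by exact: cov.
have near_pos : \forall delta \near (0 : R)^'+, (0 : R) < delta.
  exact: nbhs_right_gt.
have [delta [gd d0]] :=
  @filter_ex _ _ (at_right_proper_filter (0 : R)) _ (filterI near_good near_pos).
exists delta => // x y xab; apply: gd => /=.
by rewrite in_itv.
Unshelve. all: by end_near. Qed.

Definition cdf_of mu (x : R) : R := fine (mu `]-oo, x]%classic).

Lemma measurable_ray (x : R) : measurable (`]-oo, x]%classic : set (borel R)).
Proof.
rewrite -[X in measurable X]setCK; apply: measurableC; apply: sub_sigma_algebra.
by rewrite setCitvl; exact: interval_open.
Qed.

(** The step function on [n] cells of width [eta], open on the left, that takes on each cell the
    value of [h] at its left end; it is 0 outside the grid. *)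
Fixpoint step (h : R -> R) (a eta : R) (n : nat) (x : R) : R :=
  if n is k.+1 then
    step h a eta k x + h (a + k%:R * eta) *
      (\1_(`]-oo, a + k.+1%:R * eta]%classic) x -
       \1_(`]-oo, a + k%:R * eta]%classic) x)
  else 0.

(** The Riemann-Stieltjes sum of [h] against [G], which is the integral of [step] when [G] is the
    distribution function. *)
Fixpoint step_sum (h : R -> R) (a eta : R) (G : R -> R) (n : nat) : R :=
  if n is k.+1 then
    step_sum h a eta G k + h (a + k%:R * eta) *
      (G (a + k.+1%:R * eta) - G (a + k%:R * eta))
  else 0.

Lemma indic_ray (c x : R) : \1_(`]-oo, c]%classic) x = (x <= c)%R%:R :> R.
Proof.
rewrite indicE (_ : (x \in _) = (x <= c)%R) //.
by apply/idP/idP; rewrite inE /= in_itv.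
Qed.

Lemma step_outside h a eta n x : 0 < eta ->
  (x <= a) || (a + n%:R * eta < x) -> step h a eta n x = 0.
Proof.
move=> eta0; elim: n => //= n IH out.
have lt_step : a + n%:R * eta < a + n.+1%:R * eta.
  by rewrite ltrD2l ltr_pM2r // ltr_nat.
have ge_a : a <= a + n%:R * eta by rewrite lerDl mulr_ge0 // ltW.
rewrite !indic_ray IH; last first.
  by case/orP: out => [->//|xlt]; rewrite (lt_trans lt_step xlt) orbT.
case/orP: out => [xa|xlt].
  rewrite (le_trans xa ge_a) (le_trans xa) ?subrr ?mulr0 ?addr0 //.
  exact: le_trans ge_a (ltW lt_step).
by rewrite leNgt xlt leNgt (lt_trans lt_step xlt) subrr mulr0 addr0.
Qed.

Lemma step_inside h a eta (e : R) n x : 0 < eta ->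
    (forall u v, a <= u <= a + n%:R * eta -> u < v <= u + eta ->
      `|h v - h u| <= e) ->
  a < x <= a + n%:R * eta -> `|h x - step h a eta n x| <= e.
Proof.
move=> eta0; elim: n => [|n IH] he /andP[ax xn].
  by move: xn; rewrite mul0r addr0 leNgt ax.
have lt_step : a + n%:R * eta < a + n.+1%:R * eta.
  by rewrite ltrD2l ltr_pM2r // ltr_nat.
have ge_a : a <= a + n%:R * eta by rewrite lerDl mulr_ge0 // ltW.
rewrite /= !indic_ray xn; case: (leP x (a + n%:R * eta)) => xn'.
  rewrite subrr mulr0 addr0; apply: IH; last by rewrite ax.
  move=> u v /andP[au un] uv; apply: he => //.
  by rewrite au (le_trans un (ltW lt_step)).
rewrite step_outside ?xn' ?orbT // add0r subr0 mulr1; apply: he.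
  by rewrite ge_a ltW.
rewrite xn' /=; apply: le_trans xn _.
by rewrite -addrA lerD2l -{3}[eta]mul1r -mulrDl natr1.
Qed.

Lemma measurable_step h a eta n :
  measurable_fun setT (step h a eta n : borel R -> R).
Proof.
elim: n => [|n IH]; first exact: measurable_cst.
apply: measurable_funD => //; apply: measurable_funM; first exact: measurable_cst.
by apply: measurable_funB; apply: measurable_indic; exact: measurable_ray.
Qed.

Lemma step_bounded h a eta n : exists M, forall x, `|step h a eta n x| <= M.
Proof.
elim: n => [|n [M IH]]; first by exists 0 => x; rewrite normr0.
exists (M + `|h (a + n%:R * eta)| * (1 + 1)) => x /=.
apply: le_trans (ler_normD _ _) _; rewrite lerD // normrM ler_wpM2l //.
by apply: le_trans (ler_normB _ _) _; rewrite lerD // indic_bound.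
Qed.

Lemma Rintegral_step mu h a eta n :
  \int[mu]_x step h a eta n x = step_sum h a eta (cdf_of mu) n.
Proof.
have int_ray c : mu.-integrable setT
    (EFin \o (\1_(`]-oo, c]%classic) : borel R -> R)).
  apply: (@bounded_integrable _ _ _ _ _ 1); last exact: indic_bound.
  by apply: measurable_indic; exact: measurable_ray.
elim: n => [|n IH] /=; first exact: Rintegral_cst1.
rewrite RintegralD //; last 2 first.
- have [M bM] := step_bounded h a eta n.
  exact: bounded_integrable (measurable_step _ _ _ _) bM.
- apply: (@bounded_integrable _ _ _ _ _ (`|h (a + n%:R * eta)| * (1 + 1))).
    apply: measurable_funM; first exact: measurable_cst.
    by apply: measurable_funB; apply: measurable_indic; exact: measurable_ray.
  move=> x; rewrite normrM ler_wpM2l //.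
  by apply: le_trans (ler_normB _ _) _; rewrite lerD // indic_bound.
rewrite IH RintegralZl //; last first.
  apply: (@bounded_integrable _ _ _ _ _ (1 + 1)).
    by apply: measurable_funB; apply: measurable_indic; exact: measurable_ray.
  by move=> x; apply: le_trans (ler_normB _ _) _; rewrite lerD // indic_bound.
by rewrite RintegralB // !Rintegral_indic //; exact: measurable_ray.
Qed.

Lemma step_error mu h (M e a eta : R) n :
    continuous h -> (forall x, `|h x| <= M) -> 0 < eta -> 0 <= e ->
    (forall u v, a <= u <= a + n%:R * eta -> u < v <= u + eta ->
      `|h v - h u| <= e) ->
  `|\int[mu]_x h x - step_sum h a eta (cdf_of mu) n| <=
    e + M * (cdf_of mu a + (1 - cdf_of mu (a + n%:R * eta))).
Proof.
move=> hc hM eta0 e0 he; pose b := a + n%:R * eta.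
have M0 : 0 <= M by exact: le_trans (normr_ge0 _) (hM 0).
have mh : measurable_fun setT (h : borel R -> R).
  exact: continuous_borel_measurable.
have mray c : measurable_fun setT (\1_(`]-oo, c]%classic) : borel R -> R).
  by apply: measurable_indic; exact: measurable_ray.
have int_ray c : mu.-integrable setT
    (EFin \o (\1_(`]-oo, c]%classic) : borel R -> R)).
  apply: (@bounded_integrable _ _ _ _ _ 1); [exact: mray|exact: indic_bound].
have int_h := bounded_integrable mu mh hM.
have [K bK] := step_bounded h a eta n.
have int_step := bounded_integrable mu (measurable_step h a eta n) bK.
(* [g] dominates the error pointwise: [e] for the oscillation within the grid, [M] for the two tails
   where the step function is 0. *)
pose g (x : borel R) : R :=
  e + M * (\1_(`]-oo, a]%classic) x + (1 - \1_(`]-oo, b]%classic) x)).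
have mg : measurable_fun setT g.
  apply: measurable_funD; first exact: measurable_cst.
  apply: measurable_funM; first exact: measurable_cst.
  by apply: measurable_funD => //; apply: measurable_funB.
have int_part : mu.-integrable setT
    (EFin \o (fun x : borel R =>
       \1_(`]-oo, a]%classic) x + (1 - \1_(`]-oo, b]%classic) x))).
  apply: (@bounded_integrable _ _ _ _ _ (1 + (1 + 1))).
    by apply: measurable_funD => //; apply: measurable_funB.
  move=> x; apply: le_trans (ler_normD _ _) _; rewrite lerD ?indic_bound //.
  by apply: le_trans (ler_normB _ _) _; rewrite normr1 lerD // indic_bound.
have -> : e + M * (cdf_of mu a + (1 - cdf_of mu b)) = \int[mu]_x g x.
  rewrite RintegralD //; last 2 first.
  - exact: finite_measure_integrable_cst.
  - apply: (@bounded_integrable _ _ _ _ _ (M * (1 + (1 + 1)))).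
      apply: measurable_funM; first exact: measurable_cst.
      by apply: measurable_funD => //; apply: measurable_funB.
    move=> x; rewrite normrM ger0_norm // ler_wpM2l //.
    apply: le_trans (ler_normD _ _) _; rewrite lerD ?indic_bound //.
    by apply: le_trans (ler_normB _ _) _; rewrite normr1 lerD // indic_bound.
  rewrite Rintegral_cst1 RintegralZl // RintegralD //; last first.
    apply: (@bounded_integrable _ _ _ _ _ (1 + 1)); first exact: measurable_funB.
    move=> x; apply: le_trans (ler_normB _ _) _.
    by rewrite normr1 lerD // indic_bound.
  rewrite RintegralB //; last exact: finite_measure_integrable_cst.
  by rewrite Rintegral_cst1 !Rintegral_indic //; exact: measurable_ray.
rewrite -Rintegral_step -RintegralB //.
have int_diff : mu.-integrable setT
    (EFin \o (fun x : borel R => h x - step h a eta n x)).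
  apply: (@bounded_integrable _ _ _ _ _ (M + K)).
    by apply: measurable_funB => //; exact: measurable_step.
  by move=> x; apply: le_trans (ler_normB _ _) _; exact: lerD.
apply: le_trans (le_normr_Rintegral measurableT int_diff) _.
apply: le_Rintegral => //.
- apply: (@bounded_integrable _ _ _ _ _ (M + K)).
    apply: measurableT_comp => //; apply: measurable_funB => //.
    exact: measurable_step.
  by move=> x; rewrite normr_id; apply: le_trans (ler_normB _ _) _; exact: lerD.
- apply: (@bounded_integrable _ _ _ _ _ (e + M * (1 + (1 + 1)))) => // x.
  apply: le_trans (ler_normD _ _) _; rewrite ger0_norm // lerD2l.
  rewrite normrM ger0_norm // ler_wpM2l //.
  apply: le_trans (ler_normD _ _) _; rewrite lerD ?indic_bound //.
  by apply: le_trans (ler_normB _ _) _; rewrite normr1 lerD // indic_bound.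
move=> x _; rewrite /g !indic_ray.
have ab : a <= b by rewrite lerDl mulr_ge0 // ltW.
have [xa|ax] := leP x a.
  rewrite step_outside ?xa // subr0 (le_trans xa ab) subrr addr0 mulr1.
  by rewrite (le_trans (hM x)) // lerDr.
have [xb|bx] := leP x b.
  by rewrite subrr addr0 mulr0 addr0; apply: step_inside; rewrite ?ax.
rewrite step_outside ?bx ?orbT // !subr0 add0r mulr1.
by rewrite (le_trans (hM x)) // lerDr.
Qed.

Lemma cdf_of_tails mu (e : R) : 0 < e ->
  exists2 c : R, 0 < c & cdf_of mu (- c) < e /\ 1 - cdf_of mu c < e.
Proof.
move=> e0; pose X : borel R -> R := idfun.
have mX : measurable_fun setT X.
  by apply: continuous_borel_measurable => x; exact: cvg_id.
pose HX := isMeasurableFun.Build _ _ _ _ X mX.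
pose Y : {RV mu >-> R} := HB.pack X HX.
have /fine_cvg/cvgrPdist_lt/(_ _ e0) lo := @cvg_cdfNy0 _ _ _ mu Y.
have /fine_cvg/cvgrPdist_lt/(_ _ e0) hi := @cvg_cdfy1 _ _ _ mu Y.
have [l [_ lN]] := lo; have [u [_ uN]] := hi.
(* The entry 1 makes [c] positive; the other two put [- c] and [c] strictly beyond the thresholds
   [l] and [u]. *)
pose c := Num.max 1 (Num.max (1 - l) (1 + u)).
have c0 : 0 < c by rewrite lt_max ltr01.
have cl : - c < l.
  rewrite ltrNl; apply: (@lt_le_trans _ _ (1 - l)); first by rewrite ltrDr.
  by rewrite !le_max lexx orbT.
have cu : u < c.
  apply: (@lt_le_trans _ _ (1 + u)); first by rewrite ltrDr.
  by rewrite !le_max lexx !orbT.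
exists c => //; split.
  have := lN _ cl; rewrite /= sub0r normrN; apply: le_lt_trans; exact: ler_norm.
have := uN _ cu; rewrite /=; apply: le_lt_trans; exact: ler_norm.
Qed.

Lemma cvg_step_sum I (F : set_system I) (FF : Filter F) (G_ : I -> R -> R) G
    h a eta n :
    (forall x, G_ i x @[i --> F] --> G x) ->
  step_sum h a eta (G_ i) n @[i --> F] --> step_sum h a eta G n.
Proof.
move=> cG; elim: n => [|n IH] /=; first exact: cvg_cst.
by apply: cvgD => //; apply: cvgMr; apply: cvgB.
Qed.

(** A step sum involves finitely many values of the distribution function, so it converges, and
    [step_error] controls the approximation for the limit and for nearby measures alike. *)
Lemma cvg_Rintegral_of_cdf I (F : set_system I) (FF : Filter F)
    (mu : I -> probability (borel R) R) (nu : probability (borel R) R) h (M : R) :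
    (forall x, cdf_of (mu i) x @[i --> F] --> cdf_of nu x) ->
    continuous h -> (forall x, `|h x| <= M) ->
  \int[mu i]_x h x @[i --> F] --> \int[nu]_x h x.
Proof.
move=> cF hc hM; apply/cvgrPdist_lt => e e0.
have M0 : 0 <= M by exact: le_trans (normr_ge0 _) (hM 0).
(* The budget is 3 parts for the limit (oscillation and two tails), 5 for [mu i], whose tails may be
   twice as large, and 1 for the difference of the step sums. *)
pose e1 := e / 9%:R; have e10 : 0 < e1 by rewrite divr_gt0.
pose e2 := e1 / (M + 1); have e20 : 0 < e2 by rewrite divr_gt0 // ltr_wpDl.
have Me2 : M * e2 <= e1.
  rewrite /e2 mulrCA ger_pMr // ler_pdivrMr ?mul1r ?lerDl //.
  by rewrite ltr_wpDl.
have [c c0 [clo chi]] := cdf_of_tails nu e20.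
have [delta d0 unif] := continuous_segment_uniform (- c) c hc e10.
have [n nd] : exists n : nat, 2 * c / delta < n.+1%:R.
  exists (Num.bound (2 * c / delta)).
  apply: (@lt_trans _ _ (Num.bound (2 * c / delta))%:R).
    by rewrite archi_boundP // divr_ge0 ?mulr_ge0 // ltW.
  by rewrite ltr_nat.
pose eta := 2 * c / n.+1%:R; have eta0 : 0 < eta by rewrite divr_gt0 // mulr_gt0.
have etad : eta < delta by rewrite /eta ltr_pdivrMr // [ltRHS]mulrC -ltr_pdivrMr.
have endp : - c + n.+1%:R * eta = c.
  rewrite /eta mulrCA mulfV ?pnatr_eq0 // mulr1 mulr_natl mulr2n.
  by rewrite addrA addNr add0r.
have osc u v : - c <= u <= - c + n.+1%:R * eta -> u < v <= u + eta ->
    `|h v - h u| <= e1.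
  rewrite endp => uc /andP[uv vu]; rewrite distrC ltW //; apply: unif => //.
  rewrite distrC ger0_norm ?subr_ge0 ?ltW // (le_lt_trans _ etad) //.
  by rewrite lerBlDl.
have err m := step_error m hc hM eta0 (ltW e10) osc.
rewrite endp in err.
have cS := cvg_step_sum (h := h) (a := - c) (eta := eta) (n := n.+1) FF cF.
near=> i.
have S_near : `|step_sum h (- c) eta (cdf_of nu) n.+1 -
    step_sum h (- c) eta (cdf_of (mu i)) n.+1| < e1.
  by near: i; move/cvgrPdist_lt: cS; exact.
have lo_near : `|cdf_of nu (- c) - cdf_of (mu i) (- c)| < e2.
  by near: i; have /cvgrPdist_lt := cF (- c); exact.
have hi_near : `|cdf_of nu c - cdf_of (mu i) c| < e2.
  by near: i; have /cvgrPdist_lt := cF c; exact.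
have err_nu := err nu; have err_mu := err (mu i).
have tail_nu : M * (cdf_of nu (- c) + (1 - cdf_of nu c)) <= e1 + e1.
  apply: (@le_trans _ _ (M * (e2 + e2))); last by rewrite mulrDr lerD.
  by rewrite ler_wpM2l // lerD // ltW.
have tail_mu : M * (cdf_of (mu i) (- c) + (1 - cdf_of (mu i) c)) <=
    e1 + e1 + (e1 + e1).
  apply: (@le_trans _ _ (M * (e2 + e2 + (e2 + e2)))); last by rewrite !mulrDr !lerD.
  rewrite ler_wpM2l //; move: lo_near hi_near.
  rewrite !ltr_norml => /andP[? ?] /andP[? ?].
  lra.
have e9 : e = 9%:R * e1 by rewrite /e1 mulrCA mulfV ?mulr1 ?pnatr_eq0.
have {}err_nu := le_trans err_nu (lerD (lexx e1) tail_nu).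
have {}err_mu := le_trans err_mu (lerD (lexx e1) tail_mu).
rewrite distrC in err_mu.
set S := step_sum _ _ _ (cdf_of nu) _ in err_nu S_near.
set S' := step_sum _ _ _ (cdf_of (mu i)) _ in err_mu S_near.
rewrite -(subrKA S) (le_lt_trans (ler_normD _ _)) //.
apply: (@lt_le_trans _ _ (e1 + (e1 + e1) + (e1 + (e1 + (e1 + e1 + (e1 + e1)))))).
  rewrite ler_ltD // -(subrKA S') (le_lt_trans (ler_normD _ _)) //.
  exact: ltr_leD.
rewrite e9; lra.
Unshelve. all: by end_near. Qed.

End weak_convergence_from_cdf.

(** * Distribution functions, their measures and their jumps *)

Section probability_from_cdf.
Variable R : realType.
Local Open Scope measure_display_scope.

Lemma probability_of_cdf (f : R -> R) :
    nondecreasing f -> right_continuous f ->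
    f @ -oo --> (0 : R) -> f @ +oo --> (1 : R) ->
  exists F : probability (borel R) R, forall x, cdf_of F x = f x.
Proof.
move=> fnd frc f0 f1.
pose HC := isCumulative.Build R _ R f fnd frc.
pose HB_ := isCumulativeBounded.Build R 0 1 f f0 f1.
pose cf : cumulativeBounded (0 : R) (1 : R) := HB.pack f HC HB_.
(* The Lebesgue-Stieltjes measure lives on another presentation of the Borel sets; the identity map
   carries it to the one generated by open sets. *)
pose X : measurableTypeR R -> borel R := idfun.
have mX : measurable_fun setT X.
  apply: (@measurability _ _ (measurableTypeR R) (borel R) setT _ (@open R)) => //.
  move=> _ [A oA <-]; rewrite setTI.
  exact: open_measurable.
pose HX := isMeasurableFun.Build _ _ _ _ X mX.
pose mu : probability (measurableTypeR R) R := lebesgue_stieltjes_measure cf.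
pose Y : {RV mu >-> borel R} := HB.pack X HX.
exists (distribution mu Y) => x; rewrite /cdf_of.
have := cdf_lebesgue_stieltjes_id cf x.
by rewrite /cdf /distribution /pushforward !preimage_id => ->.
Qed.

(** Continuity from above along half-open intervals shrinking to [gamma]. *)
Lemma cvg_singleton (mu : probability (borel R) R) (gamma : R) :
  (fun n => cdf_of mu gamma - cdf_of mu (gamma - n.+1%:R^-1)) @ \oo -->
    fine (mu [set gamma]).
Proof.
pose A n : set (borel R) := `]gamma - n.+1%:R^-1, gamma]%classic.
have defA n :
    A n = `]-oo, gamma]%classic `\` `]-oo, gamma - n.+1%:R^-1]%classic.
  apply/seteqP; split => x; rewrite /A /= !in_itv /=.
    by move=> /andP[ax xg]; split => //; apply/negP; rewrite -ltNge.
  by move=> [xg /negP]; rewrite -ltNge => ->.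
have mA n : measurable (A n).
  by rewrite defA; apply: measurableD; exact: measurable_ray.
have muA n : fine (mu (A n)) = cdf_of mu gamma - cdf_of mu (gamma - n.+1%:R^-1).
  rewrite defA measureD; [|exact: measurable_ray|exact: measurable_ray|]; last first.
    by rewrite ltey_eq fin_num_measure //; exact: measurable_ray.
  rewrite setIidr; last first.
    by apply: subset_itvl; rewrite bnd_simp lerBlDr lerDl invr_ge0.
  by rewrite fineB // fin_num_measure //; exact: measurable_ray.
under eq_fun do rewrite -muA.
have capA : [set gamma] = \bigcap_n A n.
  apply/seteqP; split => [_ -> n _|x Ax].
    by rewrite /A /= in_itv /= lexx andbT ltrBlDr ltrDl invr_gt0.
  have xg : x <= gamma by have := Ax 0%N I; rewrite /A /= in_itv /= => /andP[].
  apply/eqP; rewrite eq_le xg leNgt; apply/negP => ltxg.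
  have d0 : 0 < gamma - x by rewrite subr_gt0.
  pose N := Num.bound (gamma - x)^-1.
  have NP : (gamma - x)^-1 < N.+1%:R.
    apply: (@lt_trans _ _ N%:R); last by rewrite ltr_nat.
    by rewrite archi_boundP // invr_ge0 ltW.
  have := Ax N I; rewrite /A /= in_itv /= => /andP[+ _]; apply/negP; rewrite -leNgt.
  by rewrite lerBrDr addrC -lerBrDr ltW // invf_plt ?posrE // ltr0n.
apply: fine_cvg; rewrite fineK; last first.
  by rewrite fin_num_measure // capA; exact: bigcapT_measurable.
rewrite capA; apply: nonincreasing_cvg_mu => //.
- by rewrite ltey_eq fin_num_measure.
- exact: bigcapT_measurable.
- move=> m n mn; apply/subsetPset; apply: subset_itvr.
  by rewrite bnd_simp lerD2l lerN2 lef_pV2 ?posrE // ler_nat.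
Qed.

End probability_from_cdf.

(** * The limit law *)

Section toll_limits.
Variable R : realType.
Implicit Types (a : pred R) (t : utree).

Local Notation spec V := (eigenvalues (adjacency_mx R V)).

Lemma near_count (a_ : nat -> pred R) a (s : seq R) :
    (forall y, \forall n \near \oo, a_ n y = a y) ->
  \forall n \near \oo, count (a_ n) s = count a s.
Proof.
move=> aa; elim: s => [|x s IH]; first exact: nearW.
by apply: filterS2 (aa x) IH => n /= -> ->.
Qed.

(** A fixed tree has finitely many eigenvalues, so pointwise eventual equality of the predicates is
    enough. *)
Lemma near_toll (a_ : nat -> pred R) a t :
    (forall y, \forall n \near \oo, a_ n y = a y) ->
  \forall n \near \oo, utree_toll (a_ n) t = utree_toll a t.
Proof.
move=> aa; have := near_count (spec (vertices (repr t))) aa.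
have := near_count (spec (behead (vertices (repr t)))) aa.
by apply: filterS2 => n; rewrite /utree_toll /toll => -> ->.
Qed.

Lemma utree_toll_le (x : R) t : `|utree_toll (fun y => y <= x) t| <= 1.
Proof.
have /andP[t0 t1] : 0 <= toll (fun y : R => y <= x) (repr t) <= 1.
  exact: toll_le_bound.
by rewrite ger0_norm.
Qed.

Lemma near_le_left (gamma y : R) :
  \forall n \near \oo, (y <= gamma - n.+1%:R^-1) = (y < gamma).
Proof.
have [yg|gy] := ltP y gamma; last first.
  apply: nearW => n; apply/negbTE; rewrite -ltNge.
  by apply: lt_le_trans gy; rewrite ltrBlDr ltrDl invr_gt0.
have d0 : 0 < gamma - y by rewrite subr_gt0.
have := @near_infty_natSinv_lt R (PosNum d0); apply: filterS => n /= nd.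
by rewrite lerBrDr addrC -lerBrDr ltW.
Qed.

(** For each tree, the toll of the open half-line is that of some closed one, to which interlacing
    applies. *)
Lemma utree_toll_lt (x : R) t : `|utree_toll (fun y => y < x) t| <= 1.
Proof.
have [n _ /(_ n (leqnn n)) <-] := near_toll t (near_le_left x).
exact: utree_toll_le.
Qed.

Lemma utree_toll_eq (x : R) t : utree_toll (pred1 x) t =
  utree_toll (fun y => y <= x) t - utree_toll (fun y => y < x) t.
Proof.
have split_count (s : seq R) : (count (fun y => y <= x)%R s)%:R =
    (count (pred1 x) s)%:R + (count (fun y => y < x)%R s)%:R :> R.
  rewrite -natrD; congr (_%:R); elim: s => //= y s ->.
  rewrite le_eqVlt.
  by case: eqVneq => [->|_] /=; rewrite ?ltxx; [|case: (y < x)%R] => /=; lia.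
by rewrite /utree_toll /toll !split_count; ring.
Qed.

Lemma utree_toll_eq_bound (x : R) t : `|utree_toll (pred1 x) t| <= 1 + 1.
Proof.
rewrite utree_toll_eq; apply: le_trans (ler_normB _ _) _.
by rewrite lerD ?utree_toll_le ?utree_toll_lt.
Qed.

Lemma utree_toll_true t : utree_toll (fun _ : R => true) t = 1.
Proof.
rewrite /utree_toll /toll !count_predT !size_eigenvalues.
have := vertices_gt0 (repr t); case: (vertices _) => //= v V _.
by rewrite -natr1 addrAC subrr add0r.
Qed.

Lemma utree_toll_false t : utree_toll (fun _ : R => false) t = 0.
Proof. by rewrite /utree_toll /toll !count_pred0 subrr. Qed.

End toll_limits.

Section limit_law.
Variables (R : realType) (d' : measure_display) (Omega' : measurableType d').
Variables (P' : probability Omega' R) (Tlim : {RV P' >-> borel sin_tree}).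

Definition root_mean (f : utree -> R) : R := \int[P']_w f (Tlim w 0%N).

Lemma measurable_root (f : utree -> R) :
  measurable_fun setT (fun w => f (Tlim w 0%N)).
Proof.
have mf : measurable_fun setT
    ((fun s : sin_tree => f (s 0%N)) : borel sin_tree -> R).
  apply: (@continuous_borel_measurable sin_tree R) => s.
  apply: (@continuous_comp _ _ _ (fun s : sin_tree => s 0%N) f).
    exact: proj_continuous.
  exact: discrete_continuous.
exact: measurableT_comp mf (measurable_funPT Tlim).
Qed.

Lemma integrable_root (f : utree -> R) M : (forall t, `|f t| <= M) ->
  P'.-integrable setT (EFin \o (fun w => f (Tlim w 0%N))).
Proof.
move=> fM; apply: (@bounded_integrable _ _ _ _ _ M) => [|w]; last exact: fM.
exact: measurable_root.
Qed.

(** Bounded convergence, as the tolls are eventually constant at each tree. Right continuity, both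
    limits at infinity and the jumps of [limit_cdf] all reduce to this. *)
Lemma root_mean_cvg (a_ : nat -> pred R) (a : pred R) :
    (forall y, \forall n \near \oo, a_ n y = a y) ->
    (forall n t, `|utree_toll (a_ n) t| <= 1) ->
  root_mean (utree_toll (a_ n)) @[n --> \oo] --> root_mean (utree_toll a).
Proof.
move=> aa a_1; apply: (@bounded_convergence _ _ _ _ _ _ 1).
- by move=> n; exact: measurable_root.
- exact: measurable_root.
- by move=> n w; exact: a_1.
- by move=> w; apply: cvg_near_cst; exact: near_toll.
Qed.

Definition limit_cdf (x : R) : R := root_mean (utree_toll (fun y => y <= x)).

Lemma limit_cdf_right_continuous : right_continuous limit_cdf.
Proof.
move=> x; apply/cvg_at_rightP => u [xu ux].
apply: root_mean_cvg => [y|n t]; last exact: utree_toll_le.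
have [yx|xy] := leP y x; first by apply: nearW => n; rewrite (le_trans yx) // ltW.
move/cvgr_lt : ux => /(_ y xy); apply: filterS => n uy.
by apply/negbTE; rewrite -ltNge.
Qed.

Lemma limit_cdf_Ny : limit_cdf @ -oo --> (0 : R).
Proof.
apply/cvg_ninftyP => u uNy.
have -> : (0 : R) = root_mean (utree_toll (fun=> false)).
  rewrite /root_mean; under eq_Rintegral do rewrite utree_toll_false.
  by rewrite Rintegral_cst1.
apply: root_mean_cvg => [y|n t]; last exact: utree_toll_le.
move/cvgrNy_lt : uNy => /(_ y); apply: filterS => n uy.
by apply/negbTE; rewrite -ltNge.
Qed.

Lemma limit_cdf_y : limit_cdf @ +oo --> (1 : R).
Proof.
apply/cvg_pinftyP => u uy.
have -> : (1 : R) = root_mean (utree_toll (fun=> true)).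
  rewrite /root_mean; under eq_Rintegral do rewrite utree_toll_true.
  by rewrite Rintegral_cst1.
apply: root_mean_cvg => [y|n t]; last exact: utree_toll_le.
by move/cvgryPge : uy => /(_ y); apply: filterS => n ->.
Qed.

Lemma limit_cdf_jump (gamma : R) :
  (fun n => limit_cdf gamma - limit_cdf (gamma - n.+1%:R^-1)) @ \oo -->
    root_mean (utree_toll (pred1 gamma)).
Proof.
have -> : root_mean (utree_toll (pred1 gamma)) =
    limit_cdf gamma - root_mean (utree_toll (fun y => y < gamma)).
  rewrite /limit_cdf /root_mean -RintegralB //.
  - by apply: eq_Rintegral => w _; rewrite utree_toll_eq.
  - apply: integrable_root; exact: utree_toll_le.
  - apply: integrable_root; exact: utree_toll_lt.
apply: cvgB; first exact: cvg_cst.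
apply: root_mean_cvg => [y|n t]; last exact: utree_toll_le.
exact: near_le_left.
Qed.

Lemma Rintegral_star_law (f : utree -> R) M : (forall t, `|f t| <= M) ->
  \int[distribution P' (star_RV Tlim)]_s root_function f s = root_mean f.
Proof.
move=> fM; rewrite /Rintegral integral_distribution //.
  apply/measurable_EFinP.
  apply: (@continuous_borel_measurable star_seq R).
  exact: continuous_root_function.
exact: integrable_root fM.
Qed.

End limit_law.

(** * Fringe convergence turned into convergence in probability *)

Lemma continuous_evaluation (S : Type) (E : ptopologicalType) (x : S) :
  continuous (fun f : {ptws S -> E} => f x).
Proof.
move=> f; have /cvg_sup/(_ x) fx : f --> f by exact: cvg_id.
exact: cvg_trans (cvg_app (fun g : S -> E => g x) fx)
  (@initial_continuous _ _ (fun g : S -> E => g x) f).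
Qed.

Section fringe_convergence.
Variables (R : realType) (d : nat -> measure_display).
Variables (Omega : forall n, measurableType (d n)).
Variables (P : forall n, probability (Omega n) R).
Variables (T : forall n, {RV (P n) >-> borel utree}).
Variables (d' : measure_display) (Omega' : measurableType d').
Variables (P' : probability Omega' R) (Tlim : {RV P' >-> borel sin_tree}).
Hypothesis hT : cvg_probability_fringe T Tlim.

(** Fringe convergence is tested on the distance [G] between the integral of [root_function f] and
    [m]. It is bounded and weakly continuous and vanishes at the limit law, so its means tend to
    0. *)
Lemma likely_cvg_root_mean (f : utree -> R) M : (forall t, `|f t| <= M) ->
  (\int[Phi R t]_s root_function f s) @[t --> likely_trees T] -->
    root_mean Tlim f.
Proof.
move=> fM; set m := root_mean Tlim f.
have rfM s : `|root_function f s| <= M.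
  rewrite /root_function; case: (s 0%N) => [t|]; first exact: fM.
  by rewrite normr0 (le_trans _ (fM point)).
have mrf : measurable_fun setT (root_function f : borel star_seq -> R).
  apply: (@continuous_borel_measurable star_seq R).
  exact: continuous_root_function.
pose h : bounded_continuous star_seq R :=
  exist _ (root_function f)
    (conj (@continuous_root_function R f) (ex_intro _ M rfM)).
pose G (mu : weak_prob star_seq R) : R := `|integrals mu h - m|.
have mM : `|m| <= M.
  by apply: Rintegral_bound => [|w]; [exact: measurable_root|exact: fM].
have intM (mu : probability (borel star_seq) R) : `|integrals mu h| <= M.
  exact: (Rintegral_bound mu mrf rfM).
have intmM (mu : probability (borel star_seq) R) : `|integrals mu h - m| <= M + M.
  by apply: le_trans (ler_normB _ _) _; exact: lerD.
have Gc : continuous G.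
  have c1 : continuous (fun mu : weak_prob star_seq R => integrals mu h).
    move=> mu; apply: (@continuous_comp _ _ _ (fun mu : weak_prob star_seq R =>
      integrals mu) (fun z : {ptws bounded_continuous star_seq R -> R} => z h)).
      exact: initial_continuous.
    exact: continuous_evaluation.
  have c2 : continuous (fun r : R => `|r - m|).
    by move=> r; apply: cvg_norm; apply: cvgB; [exact: cvg_id|exact: cvg_cst].
  by move=> mu; apply: (@continuous_comp _ _ _ (fun nu : weak_prob star_seq R =>
    integrals nu h) (fun r : R => `|r - m|)); [exact: c1|exact: c2].
have := hT Gc _; rewrite /G.
have -> : integrals (distribution P' (star_RV Tlim)) h = m.
  exact: Rintegral_star_law fM.
rewrite subrr normr0 => cvgG.
apply: (cvg_in_mean_likely (X := fun t => integrals (Phi R t) h) (M := M + M)).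
  by move=> t; exact: intmM.
by apply: cvgG; exists (M + M) => mu; rewrite normr_id; exact: intmM.
Qed.

End fringe_convergence.

Lemma cvg_initial_topology (S : choiceType) (E : topologicalType) (f : S -> E)
    I (G : set_system I) (FG : Filter G) (phi : I -> S) (x : S) :
  (f \o phi) @ G --> f x -> phi @ G --> (x : initial_topology f).
Proof.
move=> fphi A [_ [[B oB <-] Bx BA]].
have GB := fphi B (open_nbhs_nbhs (conj oB Bx)).
exact: (@filterS _ G FG _ _ (fun i => BA (phi i)) GB).
Qed.

Lemma cvg_weak_prob (R : realType) (E : ptopologicalType) I (G : set_system I)
    (FG : Filter G) (phi : I -> weak_prob E R) (mu : weak_prob E R) :
    (forall h : bounded_continuous E R,
      integrals (phi i) h @[i --> G] --> integrals mu h) ->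
  phi @ G --> mu.
Proof.
move=> cvg_h; apply: cvg_initial_topology; apply/cvg_sup => h.
apply: (@cvg_initial_topology _ _ (fun z : bounded_continuous E R -> R => z h)).
exact: cvg_h.
Qed.

(** * Subtrees over a prescribed forest and the multiplicity of [gamma] *)

Section multiplicity_lower_bound.
Variables (R : realType) (u : {mset utree}%mset) (gamma : R).

Local Notation cp V := (char_poly (adjacency_mx R V)).

(** A product over the components depends neither on their order nor on the representatives chosen
    for them. *)
Lemma delete_root_char_poly (s : ptree) : delete_root (iso_class s) = u ->
  cp (behead (vertices s)) = char_poly (forest_adjacency R u).
Proof.
move=> defu; set r := repr (iso_class s).
have [_ <-] := rooted_iso_char_poly R (repr_iso_class s).
rewrite behead_vertices char_poly_branches char_poly_forest_vertices -defu.
rewrite big_map /delete_root -/r.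
have pm := perm_eq_seq_mset [seq iso_class s | s <- children r].
rewrite (perm_big _ pm) big_map /=.
apply: eq_bigr => t _.
by have [] := rooted_iso_char_poly R (repr_iso_class t).
Qed.

Hypothesis mult : (1 < mup gamma (char_poly (forest_adjacency R u)))%N.

Lemma delete_root_le_multiplicity (t : ptree) :
  (\sum_(v <- vertices t) (delete_root (iso_class (subtree t v)) == u) <=
     count_mem gamma (eigenvalues (tree_adjacency R t)))%N.
Proof.
(* The size of a characteristic polynomial is one more than the dimension; here that one accounts
   for the root, so [N] is the number of vertices of every subtree over [u]. *)
pose N := size (char_poly (forest_adjacency R u)).
apply: (count_subtrees_le_multiplicity (N := N)
  (a := fun s => delete_root (iso_class s) == u)) => s /eqP su.
  rewrite /N -(delete_root_char_poly su) size_char_poly.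
  by case: s {su} => ts.
rewrite -behead_vertices -mup_char_poly ?trmx_adjacency //.
by rewrite delete_root_char_poly.
Qed.

End multiplicity_lower_bound.

(** * Limit law, atoms and positivity for fringe-convergent trees *)

Theorem theorem4p1 (R : realType)
    (d : nat -> measure_display) (Omega : forall n, measurableType (d n))
    (P : forall n, probability (Omega n) R)
    (T : forall n, {RV (P n) >-> borel utree})
    (d' : measure_display) (Omega' : measurableType d')
    (P' : probability Omega' R) (Tlim : {RV P' >-> borel sin_tree})
    (hT : cvg_probability_fringe T Tlim) :
  exists F : probability (borel R) R,
    cvg_in_distribution (E := weak_prob R R) P
      (fun n w => spectral_distribution R (T n w)) F /\
    exists c : R -> R,
      (forall gamma : R,
         cvg_in_distribution P
           (fun n w => fine (spectral_distribution R (T n w) [set gamma]))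
           (c gamma) /\
         ((c gamma)%:E <= F [set gamma])%E) /\
      (forall (u : {mset utree}%mset) (gamma : R) (L : nat),
         mup gamma (char_poly (forest_adjacency R u)) = L -> (1 < L)%N ->
         (0 < P' [set w | delete_root (Tlim w 0%N) = u])%E ->
         0 < c gamma /\ (0 < F [set gamma])%E).
Proof.
have cdf_cvg x : cdf_of (spectral_distribution R t) x @[t --> likely_trees T] -->
    limit_cdf Tlim x.
  have toll_cvg := likely_cvg_root_mean hT (utree_toll_le x).
  apply: cvg_trans toll_cvg; apply: near_eq_cvg; apply: nearW => t.
  rewrite (Rintegral_Phi _ (utree_toll_le x)) /cdf_of.
  rewrite (fine_spectral_distribution _ (measurable_ray x)
    (a := fun y => y <= x)) //.
(* The toll of a half-line need not increase with [x], so monotonicity is inherited from the random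
   distribution functions instead. *)
have cdf_nd : nondecreasing (limit_cdf Tlim).
  move=> x y xy; apply: ler_cvg_to (cdf_cvg x) (cdf_cvg y) _.
  apply: nearW => t; rewrite /cdf_of fine_le ?fin_num_measure //;
    try exact: measurable_ray.
  apply: le_measure; rewrite ?inE; try exact: measurable_ray.
  exact: subset_itvl.
have [F cdfF] := probability_of_cdf cdf_nd (@limit_cdf_right_continuous _ _ _ _ Tlim)
  (limit_cdf_Ny Tlim) (limit_cdf_y Tlim).
have m1 gamma : measurable ([set gamma] : set (borel R)).
  rewrite -[X in measurable X]setCK; apply: measurableC; apply: sub_sigma_algebra.
  exact/closed_openC/accessible_closed_set1/hausdorff_accessible/Rhausdorff.
pose c gamma := root_mean Tlim (utree_toll (pred1 gamma)).
(* Both sides are the limit of the same jumps of [limit_cdf], so the required inequality even holds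
   with equality. *)
have F1 gamma : F [set gamma] = (c gamma)%:E.
  rewrite -[LHS]fineK ?fin_num_measure //; congr EFin.
  have := @cvg_singleton _ F gamma; under eq_fun do rewrite !cdfF.
  move=> /cvg_unique; apply; first exact: Rhausdorff.
  exact: limit_cdf_jump.
have atom_cvg gamma : fine (spectral_distribution R t [set gamma])
    @[t --> likely_trees T] --> c gamma.
  have toll_cvg := likely_cvg_root_mean hT (utree_toll_eq_bound gamma).
  apply: cvg_trans toll_cvg; apply: near_eq_cvg; apply: nearW => t.
  rewrite (Rintegral_Phi _ (utree_toll_eq_bound gamma)).
  rewrite (fine_spectral_distribution _ (m1 gamma) (a := pred1 gamma)) //.
  by move=> y /=; split => /eqP.
exists F; split.
  apply: (likely_cvg_in_distribution (phi := spectral_distribution R)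
    (E := weak_prob R R)).
  apply: cvg_weak_prob => -[h [hc [M hM]]].
  have cdf_F x : cdf_of (spectral_distribution R t) x @[t --> likely_trees T] -->
      cdf_of F x by rewrite cdfF; exact: cdf_cvg.
  exact: (@cvg_Rintegral_of_cdf R _ (likely_trees T) _ _ F h M cdf_F hc hM).
exists c; split => [gamma|u gamma L multL L1 Pu].
  split; last by rewrite F1.
  exact: (likely_cvg_in_distribution (phi := fun t =>
    fine (spectral_distribution R t [set gamma]))).
suff c_gt0 : 0 < c gamma by rewrite F1 lte_fin.
pose b (t : utree) : R := (delete_root t == u)%:R.
have b_bound t : `|b t| <= 1 by rewrite /b; case: eqP => _; rewrite ?normr1 ?normr0.
have b_cvg := likely_cvg_root_mean hT b_bound.
(* For each tree the proportion of subtrees lying over [u] is at most the mass at [gamma]; the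
   inequality passes to the limits in probability. *)
have b_le : root_mean Tlim b <= c gamma.
  apply: ler_cvg_to b_cvg (atom_cvg gamma) _; apply: nearW => t.
  rewrite (Rintegral_Phi _ b_bound) fine_empirical // size_eigenvalues.
  rewrite ler_wpM2l ?invr_ge0 //.
  have -> : \sum_(x <- eigenvalues (tree_adjacency R (repr t))) \1_[set gamma] x =
      (count_mem gamma (eigenvalues (tree_adjacency R (repr t))))%:R :> R.
    rewrite -sum1_count natr_sum [RHS]big_mkcond /=; apply: eq_bigr => x _.
    rewrite indicE; case: eqP => xg; first by rewrite mem_set.
    by rewrite memNset // => /xg.
  rewrite -natr_sum ler_nat; apply: delete_root_le_multiplicity.
  by rewrite multL.
apply: lt_le_trans b_le.
set A := [set w | _] in Pu.
have mA : measurable A.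
  have -> : A = setT `&` (fun w => b (Tlim w 0%N)) @^-1` [set 1].
    apply/seteqP; split => w; rewrite setTI /A /b /=.
      by move=> ->; rewrite eqxx.
    by case: eqP => // _ /eqP; rewrite eq_sym oner_eq0.
  exact: measurable_root.
have -> : root_mean Tlim b = fine (P' A).
  rewrite -Rintegral_indic //; apply: eq_Rintegral => w _; rewrite indicE /b.
  by case: eqP => wu; [rewrite mem_set|rewrite memNset].
by rewrite fine_gt0 // Pu /= ltey_eq fin_num_measure.
Qed.
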